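(* Let $n\ge 1$ and let $\mathcal{G}$ be an abelian subgroup of $GA(n,\mathbb{C})$. Let $P$, $\eta$, $r$, $\mathfrak{g}$, $w_0$ be associated to $\mathcal{G}$ as in the context. The following are equivalent: (i) $\mathcal{G}$ is hypercyclic; (ii) the orbit $\mathcal{G}(w_0)$ is dense in $\mathbb{C}^n$; (iii) $\mathfrak{g}_{w_0}$ is an additive subgroup dense in $\mathbb{C}^n$.
   Context: An affine map of $\mathbb{C}^n$ is $f=(A,a):x\mapsto Ax+a$ with $A\in M_n(\mathbb{C})$, $a\in\mathbb{C}^n$. $MA(n,\mathbb{C})$ is the vector space of all affine maps and $GA(n,\mathbb{C})$ is the group (under composition) of invertible ones. For a subgroup $\mathcal{G}\subset GA(n,\mathbb{C})$ and $v\in\mathbb{C}^n$, $\mathcal{G}(v)=\{f(v):f\in\mathcal{G}\}$; $\mathcal{G}$ is called hypercyclic if $\mathcal{G}(v)$ is dense in $\mathbb{C}^n$ for some $v\in\mathbb{C}^n$. Define the group homomorphism $\Phi:GA(n,\mathbb{C})\to GL(n+1,\mathbb{C})$, $\Phi(A,a)=\begin{bmatrix}1&0\\ a&A\end{bmatrix}$, and the linear map $\Psi:MA(n,\mathbb{C})\to M_{n+1}(\mathbb{C})$, $\Psi(A,a)=\begin{bmatrix}0&0\\ a&A\end{bmatrix}$, which is an isomorphism onto its image $\mathcal{F}_{n+1}=\Psi(MA(n,\mathbb{C}))$. Put $G=\Phi(\mathcal{G})$. For $m\ge1$, $\mathbb{T}_m(\mathbb{C})$ is the set of lower triangular $m\times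 m$ complex matrices all of whose diagonal entries are equal. For $\eta=(n_1,\dots,n_r)$ a sequence of positive integers with $n_1+\dots+n_r=n+1$, $\mathcal{K}_{\eta,r}(\mathbb{C})=\mathbb{T}_{n_1}(\mathbb{C})\oplus\dots\oplus\mathbb{T}_{n_r}(\mathbb{C})$ (block diagonal matrices) and $\mathcal{K}^*_{\eta,r}(\mathbb{C})=\mathcal{K}_{\eta,r}(\mathbb{C})\cap GL(n+1,\mathbb{C})$. There always exist $P\in\Phi(GA(n,\mathbb{C}))$ and such an $\eta$ with $P^{-1}GP\subset\mathcal{K}^*_{\eta,r}(\mathbb{C})\cap\Phi(GA(n,\mathbb{C}))$; fix such a choice. With $\exp$ the matrix exponential on $M_{n+1}(\mathbb{C})$, set $\mathrm{g}=\exp^{-1}(G)\cap P\mathcal{K}_{\eta,r}(\mathbb{C})P^{-1}\cap\mathcal{F}_{n+1}$, $\mathfrak{g}=\Psi^{-1}(\mathrm{g})\subset MA(n,\mathbb{C})$, and $\mathfrak{g}_v=\{f(v):f\in\mathfrak{g}\}$ for $v\in\mathbb{C}^n$. Let $u_0=[e_{1,1},\dots,e_{r,1}]^T\in\mathbb{C}^{n+1}$, where $e_{k,1}=[1,0,\dots,0]^T\in\mathbb{C}^{n_k}$; let $v_0=Pu_0\in\{1\}\times\mathbb{C}^n$; let $p_2:\mathbb{C}^{n+1}\to\mathbb{C}^n$, $p_2(x_1,\dots,x_{n+1})=(x_2,\dots,x_{n+1})$; and let $w_0=p_2(v_0)\in\mathbb{C}^n$. *)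

(* Defs.v *)
From HB Require Import structures.
From mathcomp Require Import all_boot all_order all_algebra.
From mathcomp Require Import complex.
From mathcomp Require Import boolp classical_sets reals topology normedtype.
From mathcomp Require Import sequences.

Set Implicit Arguments.
Unset Strict Implicit.
Unset Printing Implicit Defensive.

Import Order.TTheory GRing.Theory Num.Theory.
Import numFieldNormedType.Exports.

Local Open Scope classical_set_scope.
Local Open Scope ring_scope.

(* R[i] carries no topology in the library; it receives here the one that its
   modulus induces on any numFieldType, and matrices over R[i] then inherit the
   product topology. *)
HB.instance Definition _ (R : rcfType) := NormedModule.copy R[i] R[i]^o.

(* The pair (A, a) is the map x |-> A x + a. *)
Definition MA (R : realType) (n : nat) : Type := ('M[R[i]]_n * 'cV[R[i]]_n)%type.

Section AffineMaps.
Variables (R : realType) (n : nat).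
Implicit Types (f g : MA R n) (S : set (MA R n)) (v : 'cV[R[i]]_n).

Definition aff_app f v : 'cV[R[i]]_n := f.1 *m v + f.2.

Definition aff_id : MA R n := (1%:M, 0).

Definition aff_comp f g : MA R n := (f.1 *m g.1, f.1 *m g.2 + f.2).

Definition aff_inverse f g : Prop :=
  aff_comp f g = aff_id /\ aff_comp g f = aff_id.

Definition GA : set (MA R n) := [set f | exists g, aff_inverse f g].

Definition is_subgroup_GA S : Prop :=
  [/\ S `<=` GA,
      S aff_id,
      forall f g, S f -> S g -> S (aff_comp f g)
    & forall f, S f -> exists2 g, S g & aff_inverse f g].

Definition is_abelian S : Prop :=
  forall f g, S f -> S g -> aff_comp f g = aff_comp g f.

(* {f(v) : f in S}: the orbit S(v) when S is a group; also used for
   S = frakg, which is not a subgroup of GA. *)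
Definition aff_orbit S v : set 'cV[R[i]]_n := [set aff_app f v | f in S].

Definition hypercyclic S : Prop := exists v, dense (aff_orbit S v).

Definition Phi f : 'M[R[i]]_n.+1 :=
  block_mx (1%:M : 'M_1) (0 : 'M_(1, n)) f.2 f.1.

Definition Psi f : 'M[R[i]]_n.+1 :=
  block_mx (0 : 'M_1) (0 : 'M_(1, n)) f.2 f.1.

Definition calF : set 'M[R[i]]_n.+1 := range Psi.

End AffineMaps.

Arguments GA {R n}.
Arguments calF {R n}.

Definition expmx (R : realType) (n : nat) (M : 'M[R[i]]_n.+1) : 'M[R[i]]_n.+1 :=
  limn (series (fun k : nat => (k`!%:R : R[i])^-1 *: M ^+ k)).

Definition TT (R : realType) (m : nat) : set 'M[R[i]]_m :=
  [set M | is_trig_mx M /\ forall i j, M i i = M j j].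

(* The sequence eta = (n_1, ..., n_r) is a function on 'I_r. The type of
   \mxdiag_i B i is 'M_(\sum_i eta i), hence the cast along
   \sum_i eta i = n.+1. *)
Section Blocks.
Variables (R : realType) (n r : nat) (eta : 'I_r -> nat).
Variable eta_sum : (\sum_i eta i)%N = n.+1.

Definition KK : set 'M[R[i]]_n.+1 :=
  [set M | exists2 B : forall i : 'I_r, 'M[R[i]]_(eta i),
      forall i, TT (B i)
    & M = castmx (eta_sum, eta_sum) (\mxdiag_(i < r) B i)].

Definition KKstar : set 'M[R[i]]_n.+1 := KK `&` [set M | M \in unitmx].

Definition u0 : 'cV[R[i]]_n.+1 :=
  castmx (eta_sum, erefl 1%N)
    (\mxcol_(i < r) \col_(j < eta i) (if j == 0 :> nat then 1 else 0)).

Definition w0 (P : 'M[R[i]]_n.+1) : 'cV[R[i]]_n :=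
  dsubmx (P *m u0 : 'cV[R[i]]_(1 + n)).

Definition rmg (G : set (MA R n)) (P : 'M[R[i]]_n.+1) : set 'M[R[i]]_n.+1 :=
  (@expmx R n @^-1` (@Phi R n @` G))
  `&` [set P *m M *m invmx P | M in KK]
  `&` calF.

Definition frakg (G : set (MA R n)) (P : 'M[R[i]]_n.+1) : set (MA R n) :=
  @Psi R n @^-1` rmg G P.

End Blocks.

(* Main.v *)
Require Import Defs.
From HB Require Import structures.
From mathcomp Require Import all_boot all_order all_algebra.
From mathcomp Require Import complex ring lra.
From mathcomp Require Import boolp classical_sets reals topology normedtype.
From mathcomp Require Import sequences exp trigo.

Set Implicit Arguments.
Unset Strict Implicit.
Unset Printing Implicit Defensive.

Import Order.TTheory GRing.Theory Num.Theory.
Import numFieldNormedType.Exports.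
Import ComplexField.Normc.

Local Open Scope classical_set_scope.
Local Open Scope ring_scope.

(* Conjugating by P, let G be the matrix group inside K, the block-diagonal
   lower triangular matrices with constant diagonal on each block.  On K the
   exponential is explicit: M = D + N with D diagonal, N strictly lower
   triangular and DN = ND.  Two facts follow.  First, an element of K commuting
   with exp M commutes with M; so the double centralizer V of G in K is a
   commutative algebra containing G, its logarithms, and stable under exp and
   log.  Second, exp has a right inverse log, continuous at 1.

   If G u is dense in {1} x C^n, or the logarithms of G applied to u are dense
   in {0} x C^n and u has first coordinate 1, then V u is the whole space; as V
   is commutative, an element D of V is controlled by D u.  Hence approximating
   vectors A u amounts to approximating matrices A in V, which makes exp and log
   transport density between G and its logarithms; and some A in V with A u = u0
   transports density from u to u0. *)

(** * A submultiplicative norm on matrices *)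

Section MatrixNorm.
Context {R : realType}.
Local Notation C := R[i].

(** The entry sum is submultiplicative and takes its values in [R]; the matrix topology is only an
    entrywise one, with radii in [C]. *)
Definition l1norm m n (A : 'M[C]_(m, n)) : R := \sum_i \sum_j normc (A i j).

Lemma normc_ge0 (z : C) : 0 <= normc z.
Proof. by case: z => a b; exact: sqrtr_ge0. Qed.

Lemma normc_real (x : R) : normc x%:C%C = `|x|.
Proof. by rewrite /normc /= expr0n addr0 sqrtr_sqr. Qed.

Lemma normr_normc (z : C) : `|z| = (normc z)%:C%C.
Proof. by []. Qed.

Lemma l1norm_ge0 m n (A : 'M[C]_(m, n)) : 0 <= l1norm A.
Proof. by apply: sumr_ge0 => i _; apply: sumr_ge0 => j _; exact: normc_ge0. Qed.

Lemma l1norm0 m n : l1norm (0 : 'M[C]_(m, n)) = 0.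
Proof. by rewrite /l1norm big1 // => i _; rewrite big1 // => j _; rewrite mxE normc0. Qed.

Lemma l1norm_entry m n (A : 'M[C]_(m, n)) i j : normc (A i j) <= l1norm A.
Proof.
rewrite /l1norm (bigD1 i) //= (bigD1 j) //= -addrA lerDl addr_ge0 //.
  by apply: sumr_ge0 => k _; exact: normc_ge0.
by apply: sumr_ge0 => k _; apply: sumr_ge0 => l _; exact: normc_ge0.
Qed.

Lemma l1norm_eq0 m n (A : 'M[C]_(m, n)) : l1norm A <= 0 -> A = 0.
Proof.
move=> A0; apply/matrixP => i j; rewrite mxE; apply: eq0_normc.
by apply/eqP; rewrite eq_le normc_ge0 (le_trans (l1norm_entry A i j)).
Qed.

Lemma l1normD m n (A B : 'M[C]_(m, n)) : l1norm (A + B) <= l1norm A + l1norm B.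
Proof.
rewrite /l1norm -big_split; apply: ler_sum => i _; rewrite -big_split.
by apply: ler_sum => j _; rewrite mxE le_normcD.
Qed.

Lemma l1normN m n (A : 'M[C]_(m, n)) : l1norm (- A) = l1norm A.
Proof. by apply: eq_bigr => i _; apply: eq_bigr => j _; rewrite mxE normcN. Qed.

Lemma l1normBC m n (A B : 'M[C]_(m, n)) : l1norm (A - B) = l1norm (B - A).
Proof. by rewrite -l1normN opprB. Qed.

Lemma l1normB m n (A B : 'M[C]_(m, n)) : l1norm (A - B) <= l1norm A + l1norm B.
Proof. by rewrite -(l1normN B) l1normD. Qed.

Lemma l1norm_sum m n (I : Type) (s : seq I) (Q : pred I) (F : I -> 'M[C]_(m, n)) :
  l1norm (\sum_(i <- s | Q i) F i) <= \sum_(i <- s | Q i) l1norm (F i).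
Proof.
elim/big_rec2 : _ => [|i x y _ h]; first by rewrite l1norm0.
by rewrite (le_trans (l1normD _ _)) // lerD2l.
Qed.

Lemma l1normZ m n c (A : 'M[C]_(m, n)) : l1norm (c *: A) = normc c * l1norm A.
Proof.
rewrite /l1norm mulr_sumr; apply: eq_bigr => i _; rewrite mulr_sumr.
by apply: eq_bigr => j _; rewrite mxE normcM.
Qed.

Lemma normc_sum (I : Type) (s : seq I) (Q : pred I) (F : I -> C) :
  normc (\sum_(i <- s | Q i) F i) <= \sum_(i <- s | Q i) normc (F i).
Proof.
elim/big_rec2 : _ => [|i x y _ h]; first by rewrite normc0.
by rewrite (le_trans (le_normcD _ _)) // lerD2l.
Qed.

Lemma l1normM m n p (A : 'M[C]_(m, n)) (B : 'M[C]_(n, p)) :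
  l1norm (A *m B) <= l1norm A * l1norm B.
Proof.
rewrite /l1norm mulr_suml; apply: ler_sum => i _.
apply: (@le_trans _ _ (\sum_j \sum_k normc (A i k) * normc (B k j))).
  apply: ler_sum => j _; rewrite mxE (le_trans (normc_sum _ _ _)) //.
  by apply: ler_sum => k _; rewrite normcM.
rewrite exchange_big /= mulr_suml; apply: ler_sum => k _.
rewrite -mulr_sumr ler_wpM2l ?normc_ge0 // (bigD1 k) //= lerDl.
by apply: sumr_ge0 => l _; apply: sumr_ge0 => j _; exact: normc_ge0.
Qed.

(** The factor [l1norm 1], equal to the dimension, is there for [k = 0]; [l1normXS] does without it
    for positive powers. *)
Lemma l1normX n (A : 'M[C]_n.+1) k : l1norm (A ^+ k) <= l1norm (1 :
  'M[C]_n.+1) * l1norm A ^+ k.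
Proof.
elim: k => [|k IH]; first by rewrite !expr0 mulr1.
rewrite !exprSr (le_trans (l1normM _ _)) // mulrA ler_wpM2r // l1norm_ge0 //.
Qed.

Lemma l1normXS n (A : 'M[C]_n.+1) k : l1norm (A ^+ k.+1) <= l1norm A ^+ k.+1.
Proof.
elim: k => [|k IH]; first by rewrite !expr1.
rewrite exprSr [leRHS]exprSr (le_trans (l1normM _ _)) // ler_wpM2r // l1norm_ge0 //.
Qed.

Definition tendsto m n (u : nat -> 'M[C]_(m, n)) X :=
  (fun k => l1norm (u k - X)) @ \oo --> (0 : R).

Lemma squeeze_cvg0 (u v : nat -> R) :
  (forall k, 0 <= u k <= v k) -> v @ \oo --> (0 : R) -> u @ \oo --> (0 : R).
Proof.
move=> uv v0; apply: (@squeeze_cvgr _ _ _ _ (fun=> 0) v u) => //.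
- by apply: nearW => k; exact: uv.
- exact: cvg_cst.
Qed.

Lemma tendsto_mul m n p (u : nat -> 'M[C]_(m, n)) (v : nat -> 'M[C]_(n, p)) X Y :
  tendsto u X -> tendsto v Y -> tendsto (fun k => u k *m v k) (X *m Y).
Proof.
move=> uX vY; apply: (@squeeze_cvg0 _ (fun k =>
  l1norm (u k - X) * (l1norm (v k - Y) + l1norm Y)
    + l1norm X * l1norm (v k - Y))) => [k|].
  rewrite l1norm_ge0 /=.
  have -> : u k *m v k - X *m Y = (u k - X) *m v k + X *m (v k - Y).
    by rewrite mulmxBl mulmxBr addrA subrK.
  apply: (le_trans (l1normD _ _)); rewrite lerD ?l1normM // (le_trans (l1normM _ _)) //.
  by rewrite ler_wpM2l ?l1norm_ge0 // -[in leLHS](subrK Y (v k)) l1normD.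
have h1 : (fun k => l1norm (v k - Y) + l1norm Y) @ \oo --> 0 + l1norm Y.
  by apply: cvgD => //; exact: cvg_cst.
have h2 : (fun k => l1norm X * l1norm (v k - Y)) @ \oo --> l1norm X * 0.
  by apply: cvgM => //; exact: cvg_cst.
have := @cvgD _ _ _ _ _ _ _ _ _ (@cvgM _ _ _ _ _ _ _ _ uX h1) h2.
rewrite mul0r mulr0 addr0; exact.
Qed.



End MatrixNorm.

(** * The matrix exponential *)

Section PartialSums.
Variables (F : numFieldType) (A : algType F).
Implicit Types a b : A.

(** Any algebra is allowed, so that one identity serves matrices and the real numbers that majorize
    them. *)
Definition exp_psum (K : nat) a : A := \sum_(k < K) (k`!%:R : F)^-1 *: a ^+ k.

Lemma sum_triangle (V : zmodType) (w : nat -> nat -> V) (K : nat) :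
  \sum_(k < K) \sum_(i < k.+1) w i (k - i)%N = \sum_(i < K) \sum_(j < K - i) w i j.
Proof.
elim: K => [|K IH]; first by rewrite !big_ord0.
rewrite big_ord_recr /= IH [in RHS]big_ord_recr /= subSnn big_ord1.
rewrite [X in _ + X]big_ord_recr /= subnn addrA; congr (_ + _).
rewrite -big_split; apply: eq_bigr => i _ /=.
by rewrite subSn 1?ltnW // big_ord_recr.
Qed.

(** The product is a sum over the square [i, j < K]. By the binomial formula [exp_psum K (a + b)] is
    its part [i + j < K], and the complementary corner remains. *)
Lemma exp_psumD a b K : GRing.comm a b ->
  exp_psum K a * exp_psum K b - exp_psum K (a + b) =
  \sum_(i < K) \sum_(j < K | (K <= i + j)%N)
     ((i`!%:R : F)^-1 * (j`!%:R)^-1) *: (a ^+ i * b ^+ j).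
Proof.
move=> cab; pose w i j := ((i`!%:R : F)^-1 * (j`!%:R)^-1) *: (a ^+ i * b ^+ j).
have -> : exp_psum K (a + b) = \sum_(i < K) \sum_(j < K | (i + j < K)%N) w i j.
  transitivity (\sum_(i < K) \sum_(j < K - i) w i j).
    rewrite -sum_triangle; apply: eq_bigr => k _.
    rewrite addrC exprDn_comm; last exact: commr_sym.
    rewrite scaler_sumr; apply: eq_bigr => i _.
    have ik : (i <= k)%N by rewrite -ltnS.
    rewrite /w -[X in _ *: X = _]scaler_nat scalerA.
    have -> : b ^+ (k - i) * a ^+ i = a ^+ i * b ^+ (k - i).
      by apply: commr_sym; apply: commrX; apply: commr_sym; apply: commrX;
        apply: commr_sym.
    congr (_ *: _); rewrite -(bin_fact ik) !natrM; field.
    by rewrite !pnatr_eq0 -!lt0n !fact_gt0 bin_gt0 ik.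
  apply: eq_bigr => i _; rewrite (big_ord_widen K) ?leq_subr //.
  by apply: eq_bigl => j; rewrite ltn_subRL.
have -> : exp_psum K a * exp_psum K b = \sum_(i < K) \sum_(j < K) w i j.
  rewrite mulr_suml; apply: eq_bigr => i _; rewrite mulr_sumr.
  by apply: eq_bigr => j _; rewrite -scalerAl -scalerAr scalerA.
rewrite -sumrB; apply: eq_bigr => i _.
rewrite [X in X - _](bigID (fun j : 'I_K => i + j < K)%N) /=.
rewrite [X in X - _]addrC addrK.
by apply: eq_bigl => j; rewrite -leqNgt.
Qed.

End PartialSums.

(** * Convergence of the exponential series, multiplicativity, and continuity at 0 *)

Section ExpSeries.
Context {R : realType}.
Local Notation C := R[i].

Lemma exp_psum_real (x : R) K : exp_psum K (x : R^o) = series (exp_coeff x) K.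
Proof.
rewrite /exp_psum seriesEord; apply: eq_bigr => k _; rewrite /exp_coeff /= mulrC;
  congr (_ * _).
Qed.

Lemma exp_psum_real_cvg (x : R) : (fun K => exp_psum K (x : R^o)) @ \oo --> expR x.
Proof.
rewrite (_ : (fun K => _) = series (exp_coeff x)).
  exact: is_cvg_series_exp_coeff.
by apply/funext => K; rewrite exp_psum_real.
Qed.

Definition expmx_to n (M X : 'M[C]_n.+1) := tendsto (fun K => exp_psum K M) X.

(** The corner of [exp_psumD] is majorized termwise by the same corner for the real numbers
    [l1norm A] and [l1norm B]. That one tends to 0 because [expR] is multiplicative, which yields
    [expmx_to_add]. *)
Lemma expmx_to_comm_exp_psum n (A B : 'M[C]_n.+1) K : GRing.comm A B ->
  l1norm (exp_psum K A * exp_psum K B - exp_psum K (A + B)) <=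
  l1norm (1 : 'M[C]_n.+1) ^+ 2 * (exp_psum K (l1norm A :
    R^o) * exp_psum K (l1norm B : R^o)
                 - exp_psum K (l1norm A + l1norm B : R^o)).
Proof.
move=> cAB; rewrite exp_psumD // exp_psumD; last exact: mulrC.
rewrite (le_trans (l1norm_sum _ _ _)) // mulr_sumr; apply: ler_sum => i _.
rewrite (le_trans (l1norm_sum _ _ _)) // mulr_sumr; apply: ler_sum => j _.
have fpos (k : nat) : normc ((k`!%:R : C)^-1) = (k`!%:R)^-1.
  by rewrite normcV -(rmorph_nat (real_complex R)) normc_real ger0_norm.
rewrite l1normZ normcM !fpos mulrCA ler_wpM2l ?mulr_ge0 ?invr_ge0 //.
rewrite (le_trans (l1normM _ _)) // expr2 mulrACA.
by rewrite ler_pM ?l1norm_ge0 ?l1normX.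
Qed.

Lemma expmx_to_add n (A B X Y : 'M[C]_n.+1) : GRing.comm A B ->
  expmx_to A X -> expmx_to B Y -> expmx_to (A + B) (X * Y).
Proof.
move=> cAB AX BY.
pose e K := l1norm (1 : 'M[C]_n.+1) ^+ 2 * (exp_psum K (l1norm A :
  R^o) * exp_psum K (l1norm B : R^o)
                 - exp_psum K (l1norm A + l1norm B : R^o)).
apply: (@squeeze_cvg0 _ _ (fun K => e K + l1norm (exp_psum K A * exp_psum K B - X * Y))) => [K|].
  rewrite l1norm_ge0 /=.
  have -> : exp_psum K (A + B) - X * Y = (exp_psum K (A + B) - exp_psum K A * exp_psum K B)
     + (exp_psum K A * exp_psum K B - X * Y) by rewrite addrA subrK.
  by rewrite (le_trans (l1normD _ _)) // lerD2r l1normBC expmx_to_comm_exp_psum.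
have e0 : e @ \oo --> l1norm (1 : 'M[C]_n.+1) ^+ 2 *
    (expR (l1norm A) * expR (l1norm B) - expR (l1norm A + l1norm B)).
  apply: cvgM; first exact: cvg_cst.
  apply: cvgB; last exact: exp_psum_real_cvg.
  by apply: cvgM; exact: exp_psum_real_cvg.
rewrite expRD subrr mulr0 in e0.
have := cvgD e0 (tendsto_mul AX BY); rewrite addr0; exact.
Qed.

Lemma expmx_to_expmx n (M X : 'M[C]_n.+1) : expmx_to M X -> expmx M = X.
Proof.
move=> MX; apply: cvg_lim; first exact: norm_hausdorff.
rewrite (_ : series _ = fun K => exp_psum K M); last first.
  by apply/funext => K; rewrite seriesEord.
(* Radii of balls are elements of [C]; a positive one is real. *)
apply/cvg_ballP => e e0; have eR : e = (complex.Re e)%:C%C.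
  by rewrite RRe_real // gtr0_real.
have re0 : 0 < complex.Re e by move: e0; rewrite ltcE /= => /andP[].
near=> K; split => // i j; rewrite eR /ball /= normr_normc ltcR.
apply: (@le_lt_trans _ _ (l1norm (exp_psum K M - X))).
  by apply: le_trans (l1norm_entry _ i j); rewrite !mxE -normcN opprB.
rewrite -[ltLHS]ger0_norm ?l1norm_ge0 //.
near: K; exact: (cvgr0_norm_lt _ MX).
Unshelve. all: end_near.
Qed.

(** Without the constant term only positive powers remain, and these satisfy [l1normXS] with no
    dimension factor; shifting the partial sums to [K.+1] isolates that term. *)
Lemma expmx_to_near1 n (M X : 'M[C]_n.+1) : expmx_to M X ->
  l1norm (X - 1) <= expR (l1norm M) - 1.
Proof.
move=> MX.
have bnd K : l1norm (X - 1) <= l1norm (exp_psum K.+1 M - X) + (exp_psum K.+1 (l1norm M : R^o) - 1).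
  have -> : X - 1 = (X - exp_psum K.+1 M) + (exp_psum K.+1 M - 1) by rewrite addrA subrK.
  rewrite (le_trans (l1normD _ _)) // l1normBC lerD2l.
  rewrite /exp_psum !big_ord_recl /= !expr0 fact0 !invr1 !scale1r.
  rewrite [1 + _]addrC addrK [X in _ <= X - 1]addrC addrK.
  rewrite (le_trans (l1norm_sum _ _ _)) //. apply: ler_sum => k _.
  rewrite l1normZ -(rmorph_nat (real_complex R)) normcV normc_real ger0_norm //.
  by rewrite ler_wpM2l ?invr_ge0 // l1normXS.
have h : (fun K => l1norm (exp_psum K.+1 M - X) + (exp_psum K.+1 (l1norm M :
  R^o) - 1)) @ \oo
   --> 0 + (expR (l1norm M) - 1).
  apply: cvgD; first by rewrite (cvg_shiftS (fun K => l1norm (exp_psum K M - X))).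
  apply: cvgB; last exact: cvg_cst.
  by rewrite (cvg_shiftS (fun K => exp_psum K (l1norm M : R^o)));
    exact: exp_psum_real_cvg.
rewrite add0r in h; rewrite -(cvg_lim _ h) //.
by apply: limr_ge; [exact: cvgP h|exact: nearW].
Qed.

End ExpSeries.

(** * The complex exponential and diagonal matrices *)

Section DiagonalExponential.
Context {R : realType}.
Local Notation C := R[i].

Definition cexp (z : C) : C :=
  Complex (expR (complex.Re z) * cos (complex.Im z))
          (expR (complex.Re z) * sin (complex.Im z)).

Lemma cexp0 : cexp 0 = 1.
Proof. by rewrite /cexp /= expR0 cos0 sin0 mulr1 mulr0. Qed.

Lemma cexp_neq0 z : cexp z != 0.
Proof.
apply/eqP => -[/eqP + /eqP]; rewrite !mulf_eq0 expR_eq0 /= => /eqP c0 /eqP s0.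
have := cos2Dsin2 (complex.Im z); rewrite c0 s0 expr0n /= addr0 => /esym/eqP.
by rewrite oner_eq0.
Qed.

Lemma l1norm_diag n (v : 'rV[C]_n) : l1norm (diag_mx v) = \sum_i normc (v 0 i).
Proof.
rewrite /l1norm; apply: eq_bigr => i _; rewrite (bigD1 i) //= mxE eqxx mulr1n.
by rewrite big1 ?addr0 // => j ij; rewrite mxE eq_sym (negbTE ij) normc0.
Qed.

Lemma diag_mxX n (v : 'rV[C]_n.+1) k :
  diag_mx v ^+ k = diag_mx (\row_i (v 0 i ^+ k)).
Proof.
elim: k => [|k IH].
  by apply/matrixP => i j; rewrite expr0 !mxE expr0.
rewrite exprS IH -[_ * _]/(_ *m _) mulmx_diag; congr diag_mx.
by apply/rowP => i; rewrite !mxE exprS.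
Qed.

Lemma exp_psum_diag n (v : 'rV[C]_n.+1) K :
  exp_psum K (diag_mx v) = diag_mx (\row_i exp_psum K (v 0 i : C^o)).
Proof.
rewrite /exp_psum; apply/matrixP => i j; rewrite summxE !mxE.
case: eqVneq => [<-|ij]; last first.
  by rewrite mulr0n big1 // => k _; rewrite diag_mxX !mxE (negbTE ij) mulr0n mulr0.
by rewrite mulr1n; apply: eq_bigr => k _; rewrite diag_mxX !mxE eqxx mulr1n.
Qed.

Lemma cvg_sum0 n (f : 'I_n -> nat -> R) :
  (forall i, f i @ \oo --> (0 : R)) -> (fun K => \sum_i f i K) @ \oo --> (0 : R).
Proof.
elim: n f => [|n IH] f f0.
  by rewrite (_ : (fun K => _) = fun=> 0); [exact: cvg_cst|apply/funext => K;
    rewrite big_ord0].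
rewrite (_ : (fun K => _) = fun K => f ord0 K + \sum_i f (lift ord0 i) K); last first.
  by apply/funext => K; rewrite big_ord_recl.
by rewrite -[X in _ --> X]addr0; apply: cvgD => //; apply: IH.
Qed.

Lemma expmx_to_diag n (v w : 'rV[C]_n.+1) :
  (forall i, (fun K => normc (exp_psum K (v 0 i : C^o) - w 0 i)) @ \oo --> (0 : R)) ->
  expmx_to (diag_mx v) (diag_mx w).
Proof.
move=> h; rewrite /expmx_to /tendsto.
rewrite (_ : (fun K => _) = fun K => \sum_i normc (exp_psum K (v 0 i : C^o) - w 0 i)).
  exact: cvg_sum0.
apply/funext => K; rewrite exp_psum_diag -linearB l1norm_diag.
by apply: eq_bigr => i _; rewrite !mxE.
Qed.

Lemma exp_psum_cexp_re (x : R) :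
  (fun K => normc (exp_psum K (x%:C%C : C^o) - (expR x)%:C%C)) @ \oo --> (0 : R).
Proof.
rewrite (_ : (fun K => _) = fun K => `|exp_psum K (x : R^o) - expR x|).
  rewrite -(normr0 R); apply: cvg_norm; rewrite -(subrr (expR x)).
  by apply: cvgB; [exact: exp_psum_real_cvg|exact: cvg_cst].
apply/funext => K.
have -> : exp_psum K (x%:C%C : C^o) = (exp_psum K (x : R^o))%:C%C.
  rewrite /exp_psum rmorph_sum; apply: eq_bigr => k _.
  by rewrite [RHS]rmorphM /= fmorphV rmorph_nat rmorphXn.
by rewrite -rmorphB normc_real.
Qed.

Lemma complex_sum (f g : nat -> R) K :
  \sum_(k < K) Complex (f k) (g k) = Complex (\sum_(k < K) f k) (\sum_(k < K) g k).
Proof. by elim: K => [|K IH]; rewrite ?big_ord0 // !big_ord_recr /= IH. Qed.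

(** Even powers of ['i] are real and produce the cosine series, odd ones are imaginary and produce
    the sine series. *)
Lemma exp_psum_im (y : R) K :
  exp_psum K ((0 +i* y)%C : C^o) = (series (cos_coeff y) K +i* series (sin_coeff y) K)%C.
Proof.
rewrite /exp_psum !seriesEord.
rewrite -complex_sum.
apply: eq_bigr => k _.
have yi : (0 +i* y)%C = 'i%C * y%:C%C by simpc.
have ik (m : nat) : ('i%C : C) ^+ m =
    if odd m then 'i%C * ((-1) ^+ m.-1./2) else (-1) ^+ m./2.
  rewrite -[in LHS](odd_double_half m) exprD -mul2n exprM sqr_i.
  case: (boolP (odd m)) => om; rewrite ?expr1 ?expr0 ?mul1r //.
  by case: m om => //= m nom; rewrite uphalf_half (negbTE nom).
have sgn m : ((-1) ^+ m : C) = ((-1) ^+ m : R)%:C%C by rewrite rmorphXn rmorphN1.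
rewrite yi exprMn ik -(rmorph_nat (real_complex R)) -fmorphV -rmorphXn !sgn.
rewrite /cos_coeff /sin_coeff /= /GRing.scale /=.
by case: (odd k); simpc; rewrite -?exprnP mulrC.
Qed.

Lemma normc_le_ReIm (z : C) : normc z <= `|complex.Re z| + `|complex.Im z|.
Proof.
rewrite [in leLHS](complexE z) (le_trans (le_normcD _ _)) // normcM !normc_real.
by rewrite lerD2l /normc /= expr0n expr1n add0r sqrtr1 mul1r.
Qed.

Lemma exp_psum_cexp_im (y : R) :
  (fun K => normc (exp_psum K ((0 +i* y)%C :
    C^o) - (cos y +i* sin y)%C)) @ \oo --> (0 : R).
Proof.
apply: (@squeeze_cvg0 _ _ (fun K => `|series (cos_coeff y) K - cos y| +
    `|series (sin_coeff y) K - sin y|)) => [K|].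
  by rewrite normc_ge0 exp_psum_im; exact: normc_le_ReIm.
rewrite -[X in _ --> X]addr0; apply: cvgD; rewrite -(normr0 R); apply: cvg_norm.
  rewrite -(subrr (cos y)); apply: cvgB; last exact: cvg_cst.
  by rewrite unlock; exact: is_cvg_series_cos_coeff.
rewrite -(subrr (sin y)); apply: cvgB; last exact: cvg_cst.
by rewrite unlock; exact: is_cvg_series_sin_coeff.
Qed.

(** The real and the imaginary parts of the entries give two commuting diagonal matrices, so
    [expmx_to_add] reduces the claim to the real exponential, cosine and sine series. *)
Lemma expmx_to_diag_cexp n (v : 'rV[C]_n.+1) :
  expmx_to (diag_mx v) (diag_mx (\row_i cexp (v 0 i))).
Proof.
pose x : 'rV[C]_n.+1 := \row_i (complex.Re (v 0 i))%:C%C.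
pose y : 'rV[C]_n.+1 := \row_i (0 +i* complex.Im (v 0 i))%C.
have -> : diag_mx v = diag_mx x + diag_mx y.
  rewrite -linearD; congr diag_mx; apply/rowP => i; rewrite !mxE.
  by case: (v 0 i) => a b; simpc.
pose ex : 'rV[C]_n.+1 := \row_i (expR (complex.Re (v 0 i)))%:C%C.
pose ey : 'rV[C]_n.+1 := \row_i (cos (complex.Im (v 0 i)) +i* sin (complex.Im (v 0 i)))%C.
have -> : diag_mx (\row_i cexp (v 0 i)) = diag_mx ex * diag_mx ey.
  rewrite -[_ * _]/(_ *m _) mulmx_diag; congr diag_mx; apply/rowP => i; rewrite !mxE.
  by rewrite /cexp; simpc.
apply: expmx_to_add.
- by rewrite /GRing.comm -[LHS]/(_ *m _) -[RHS]/(_ *m _) diag_mxC.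
- apply: expmx_to_diag => i; rewrite !mxE; exact: exp_psum_cexp_re.
- apply: expmx_to_diag => i; rewrite !mxE; exact: exp_psum_cexp_im.
Qed.

End DiagonalExponential.

(** * A complex logarithm *)

Section ComplexLog.
Context {R : realType}.
Local Notation C := R[i].

(** The principal branch: [acos] supplies an argument in the upper half plane, and its sign is
    changed below the real axis. *)
Definition clog (z : C) : C :=
  let t := acos (complex.Re z / normc z) in
  Complex (ln (normc z)) (if 0 <= complex.Im z then t else - t).

Lemma normc_gt0 (z : C) : z != 0 -> 0 < normc z.
Proof.
by move=> z0; rewrite lt_neqAle normc_ge0 andbT eq_sym; apply: contraNneq z0 =>
  /eq0_normc ->.
Qed.

Lemma sqr_normcE (z : C) : normc z ^+ 2 = complex.Re z ^+ 2 + complex.Im z ^+ 2.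
Proof. by case: z => a b; rewrite /normc sqr_sqrtr // addr_ge0 ?sqr_ge0. Qed.

Lemma Re_div_normc (z : C) : z != 0 -> -1 <= complex.Re z / normc z <= 1.
Proof.
move=> z0; have n0 := normc_gt0 z0; have := sqr_normcE z.
rewrite ler_pdivlMr // ler_pdivrMr // => h.
by apply/andP; split; have := sqr_ge0 (complex.Im z); nra.
Qed.

Lemma clogK (z : C) : z != 0 -> cexp (clog z) = z.
Proof.
move=> z0; have n0 := normc_gt0 z0; have rz := Re_div_normc z0.
rewrite /cexp /clog /= lnK ?posrE //.
set t := acos _.
have ct : normc z * cos t = complex.Re z.
  by rewrite acosK ?in_itv //= mulrC divfK // gt_eqF.
have st : normc z * sin t = `|complex.Im z|.
  rewrite sin_acos // -sqrtr_sqr.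
  have -> x : normc z * Num.sqrt x = Num.sqrt (normc z ^+ 2 * x).
    by rewrite sqrtrM ?sqr_ge0 // sqrtr_sqr ger0_norm // ltW.
  congr Num.sqrt; rewrite expr_div_n mulrBr mulr1 [X in _ - X]mulrC.
  by rewrite divfK ?expf_neq0 ?gt_eqF // sqr_normcE; ring.
case: ifPn => im.
  rewrite ct st ger0_norm //; by case: (z).
rewrite cosN sinN mulrN ct st ltr0_norm ?ltNge // opprK; by case: (z).
Qed.

Lemma clog1 : clog 1 = 0.
Proof. by rewrite /clog normc1 /= lexx ln1 divr1 acos1. Qed.

Lemma clog_near1 (eps : R) : 0 < eps ->
  exists2 d : R, 0 < d & forall z, normc (z - 1) < d -> normc (clog z) < eps.
Proof.
(* The bound 1 keeps [t] in the interval from 0 to [pi], where [cos] is decreasing. *)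
move=> e0; pose t : R := Num.min (eps / 2) 1.
have t0 : 0 < t by rewrite lt_min divr_gt0 //= ltr01.
have te : t <= eps / 2 by rewrite ge_min lexx.
have tpi : t <= pi.
  by rewrite (@le_trans _ _ 1) ?ge_min ?lexx ?orbT // (le_trans _ (pi_ge2 R)) // ler1n.
have tI : t \in `[0, pi] by rewrite in_itv /= (ltW t0).
have c1 : cos t < 1.
  by rewrite -(cos0 R) ltr_cos // in_itv /= lexx pi_ge0.
have ln_near : exists2 d : R, 0 < d & forall x, `|x - 1| < d -> `|ln x| < eps / 2.
  have /cvgrPdist_lt /(_ (eps / 2)) := @continuous_ln R 1 ltr01.
  rewrite divr_gt0 // ln1 => /(_ isT) /nbhs_ballP [d /= d0 h].
  exists d => // x xd; have := h x; rewrite /ball /= distrC => /(_ xd).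
  by rewrite sub0r normrN.
have [d d0 hd] := ln_near.
(* [d] controls the logarithm of the modulus, [2^-1] keeps [z] away from 0, and the last bound
   forces the cosine of the argument above [cos t], with a multiple of the square of [cos t - 1] to
   spare. *)
pose d' : R := Num.min (Num.min d (2^-1)) ((1 - cos t) / 2).
have d'0 : 0 < d' by rewrite !lt_min d0 invr_gt0 ltr0n divr_gt0 ?subr_gt0.
exists d' => // z; rewrite !lt_min -andbA => /and3P[zd z2 zt].
have nz : `|normc z - 1| <= normc (z - 1).
  have t1 := le_normcD (z - 1) 1; have t2 := le_normcD (1 - z) z.
  have := normcN (1 - z); rewrite opprB => t3.
  rewrite subrK (normc1 R) in t1; rewrite subrK (normc1 R) in t2.
  by rewrite ler_norml; lra.
have re : `|complex.Re z - 1| <= normc (z - 1).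
  by have := normc_ge_Re (z - 1); rewrite normr_normc lecR; case: (z).
have z0 : z != 0.
  by apply: contraTneq z2 => ->; rewrite sub0r normcN normc1 -leNgt invf_le1 // ler1n.
have n0 := normc_gt0 z0.
have ac : acos (complex.Re z / normc z) < t.
  rewrite -ltr_cos //; last first.
    by rewrite in_itv /= acos_ge0 ?acos_lepi ?Re_div_normc.
  rewrite acosK ?in_itv /= ?Re_div_normc // ltr_pdivlMr //.
  move: nz re zt; rewrite !ler_distl => /andP[_ h1] /andP[h2 _] h3.
  have := sqr_ge0 (cos t - 1); nra.
apply: le_lt_trans (normc_le_ReIm _) _; rewrite /clog /=.
have := hd (normc z) (le_lt_trans nz zd).
have : `|if 0 <= complex.Im z then acos (complex.Re z / normc z)
     else - acos (complex.Re z / normc z)| = acos (complex.Re z / normc z).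
  by case: ifP => _; rewrite ?normrN ger0_norm // acos_ge0 // Re_div_normc.
move=> ->; lra.
Qed.

End ComplexLog.

(** * Exponential and logarithm of strictly lower triangular matrices *)

Section Nilpotent.
Context {R : realType} {n : nat}.
Local Notation C := R[i].
Local Notation M := 'M[C]_n.+1.
Implicit Types A B L N X : M.

(** A filtration by depth below the diagonal: [ltrig 0] is lower triangular, [ltrig 1] strictly so.
    Depths add under products, and a depth above [n] forces 0. *)
Definition ltrig (k : nat) A := forall i j : 'I_n.+1, (i < j + k)%N -> A i j = 0.

Lemma ltrigW k l A : (k <= l)%N -> ltrig l A -> ltrig k A.
Proof. by move=> kl h i j ij; apply: h; rewrite (leq_trans ij) // leq_add2l. Qed.

Lemma ltrig0 k : ltrig k 0. Proof. by move=> i j _; rewrite mxE. Qed.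

Lemma ltrigD k A B : ltrig k A -> ltrig k B -> ltrig k (A + B).
Proof. by move=> a b i j ij; rewrite mxE a // b // addr0. Qed.

Lemma ltrigZ k c A : ltrig k A -> ltrig k (c *: A).
Proof. by move=> a i j ij; rewrite mxE a // mulr0. Qed.

Lemma ltrigN k A : ltrig k A -> ltrig k (- A).
Proof. by move=> a i j ij; rewrite mxE a // oppr0. Qed.

Lemma ltrigB k A B : ltrig k A -> ltrig k B -> ltrig k (A - B).
Proof. by move=> a b; apply: ltrigD => //; exact: ltrigN. Qed.

Lemma ltrig_sum k (I : Type) (s : seq I) (Q : pred I) (F : I -> M) :
  (forall i, Q i -> ltrig k (F i)) -> ltrig k (\sum_(i <- s | Q i) F i).
Proof.
by move=> h; elim/big_rec : _ => [|i x Qi]; [exact: ltrig0|apply: ltrigD; exact: h].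
Qed.

Lemma ltrigM k l A B : ltrig k A -> ltrig l B -> ltrig (k + l) (A * B).
Proof.
move=> a b i j ij; rewrite mxE big1 // => m _.
have [im|mi] := ltnP i (m + k); first by rewrite a // mul0r.
rewrite b ?mulr0 // -(ltn_add2r k) (leq_ltn_trans mi) //.
by rewrite -addnA (addnC l).
Qed.

Lemma ltrig_eq0 k A : (n < k)%N -> ltrig k A -> A = 0.
Proof.
move=> nk a; apply/matrixP => i j; rewrite mxE a //.
by rewrite (leq_trans (ltn_ord i)) // (leq_trans nk) // leq_addl.
Qed.

Lemma ltrig1 : ltrig 0 1.
Proof.
by move=> i j; rewrite addn0 mxE => ij; case: eqVneq ij => // ->; rewrite ltnn.
Qed.

Lemma ltrigX A k j : ltrig k A -> ltrig (k * j) (A ^+ j).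
Proof.
move=> a; elim: j => [|j IH]; first by rewrite muln0; exact: ltrig1.
by rewrite exprS mulnS; apply: ltrigM.
Qed.

Lemma commrZ A X (c : C) : GRing.comm X A -> GRing.comm X (c *: A).
Proof. by move=> h; rewrite /GRing.comm -scalerAr -scalerAl h. Qed.

Lemma comm_exp_psum A X K : GRing.comm X A -> GRing.comm X (exp_psum K A).
Proof. by move=> h; apply: commr_sum => k _; apply: commrZ; apply: commrX. Qed.

(* Two terms more than the dimension: then 1 + N is visible even for n = 0. *)
Definition nilexp N : M := exp_psum n.+2 N.

Lemma nilexpE N : nilexp N = 1 + N + \sum_(k < n) ((k.+2)`!%:R : C)^-1 *: N ^+ k.+2.
Proof.
rewrite /nilexp /exp_psum 2!big_ord_recl /= expr0 expr1 fact0 !invr1 !scale1r addrA.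
by congr (_ + _); apply: eq_bigr.
Qed.

Lemma nilexp0 : nilexp 0 = 1.
Proof. by rewrite nilexpE addr0 big1 ?addr0 // => k _; rewrite expr0n scaler0. Qed.

Lemma nilexp_tail k N : ltrig k N -> ltrig (k * 2) (nilexp N - 1 - N).
Proof.
move=> a; rewrite nilexpE -addrA -opprD [X in ltrig _ (X - _)]addrC addrK.
apply: ltrig_sum => j _; apply: ltrigZ; apply: (@ltrigW _ (k * j.+2)); last exact: ltrigX.
by rewrite leq_mul2l orbT.
Qed.

Lemma nilexp_sub1 N : ltrig 1 N -> ltrig 1 (nilexp N - 1).
Proof.
move=> a; rewrite -[X in ltrig _ X](subrK N); apply: ltrigD => //.
exact: ltrigW (nilexp_tail a).
Qed.

(** The corner terms of [exp_psumD] have [i + j >= n.+2], a depth at which every matrix vanishes. *)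
Lemma nilexpD A B : GRing.comm A B -> ltrig 1 A -> ltrig 1 B ->
  nilexp (A + B) = nilexp A * nilexp B.
Proof.
move=> cAB a b; apply/esym/eqP; rewrite -subr_eq0 exp_psumD //.
apply/eqP; rewrite big1 // => i _; rewrite big1 // => j ij.
rewrite (_ : A ^+ i * B ^+ j = 0) ?scaler0 //; apply: (@ltrig_eq0 (i + j)).
  by rewrite (leq_trans _ ij).
by apply: ltrigM; rewrite -[X in ltrig X _]mul1n; exact: ltrigX.
Qed.

Lemma expmx_to_nilexp N : ltrig 1 N -> expmx_to N (nilexp N).
Proof.
move=> a; rewrite /expmx_to /tendsto -(cvg_shiftn n.+2).
rewrite (_ : (fun K => _) = fun=> 0); first exact: cvg_cst.
apply/funext => K /=; rewrite (_ : exp_psum _ _ = nilexp N) ?subrr ?l1norm0 //.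
rewrite addnC /exp_psum big_split_ord /= [X in _ + X]big1 ?addr0 // => k _.
rewrite (_ : N ^+ _ = 0) ?scaler0 //; apply: (@ltrig_eq0 (1 * (n.+2 + k))).
  by rewrite mul1n ltn_addr.
exact: ltrigX.
Qed.

(* As A commutes with nilexp N, the commutator of A and N is a combination of the
   commutators of A and N ^+ j with j > 1, which lie one diagonal deeper. *)
Lemma comm_nilexp A N : ltrig 0 A -> ltrig 1 N -> GRing.comm A (nilexp N) ->
  GRing.comm A N.
Proof.
move=> a b cA; pose W j := A * N ^+ j - N ^+ j * A.
have WS j : W j.+1 = W j * N + N ^+ j * W 1%N.
  by rewrite /W expr1 mulrBl mulrBr !exprSr !mulrA addrA subrK.
have W1_ltrig k : ltrig k (W 1%N).
  elim: k => [|k IH].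
    rewrite /W expr1; apply: ltrigB; rewrite -[0%N]/(0 + 0)%N; apply: ltrigM => //;
      exact: ltrigW b.
  have Wj_ltrig j : ltrig (k + j) (W j.+1).
    elim: j => [|j IHj]; first by rewrite addn0.
    rewrite WS; apply: ltrigD; first by rewrite addnS -[(k + j).+1]addn1; apply: ltrigM.
    by rewrite addnC; apply: ltrigM => //; rewrite -[X in ltrig X _]mul1n; exact: ltrigX.
  have : W 1%N = - \sum_(j < n) ((j.+2)`!%:R : C)^-1 *: W j.+2.
    apply/eqP; rewrite -addr_eq0; apply/eqP.
    have -> : \sum_(j < n) ((j.+2)`!%:R : C)^-1 *: W j.+2
      = A * (\sum_(j < n) ((j.+2)`!%:R : C)^-1 *: N ^+ j.+2)
      - (\sum_(j < n) ((j.+2)`!%:R : C)^-1 *: N ^+ j.+2) * A.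
      rewrite mulr_sumr mulr_suml -sumrB; apply: eq_bigr => j _.
      by rewrite /W scalerBr -scalerAr -scalerAl.
    rewrite /W expr1; set S := \sum_(_ < n) _.
    have : A * (1 + N + S) = (1 + N + S) * A by rewrite /S -nilexpE.
    rewrite !mulrDr !mulrDl mulr1 mul1r -2!addrA => /addrI {}cA.
    by rewrite addrACA cA -opprD subrr.
  move=> ->; apply: ltrigN; apply: ltrig_sum => j _; apply: ltrigZ.
  by apply: ltrigW (Wj_ltrig j.+1); rewrite addnS ltnS leq_addr.
apply/eqP; rewrite -subr_eq0; apply/eqP.
by have := @ltrig_eq0 n.+1 _ (ltnSn n) (W1_ltrig n.+1); rewrite /W expr1.
Qed.

(* Each step moves the error nilexp L - 1 - N one diagonal deeper, so that
   n.+1 steps give an exact logarithm; iterating, rather than summing the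
   logarithmic series, makes exactness and continuity easy inductions. *)
Definition nillog_step N L : M := L - (nilexp L - 1 - N).
Definition nillog_iter N (k : nat) : M := iter k (nillog_step N) 0.
Definition nillog N : M := nillog_iter N n.+1.

Lemma comm_nillog_iter N X k : GRing.comm X N -> GRing.comm X (nillog_iter N k).
Proof.
move=> h; elim: k => [|k IH]; first exact: commr0.
rewrite /nillog_iter /= -/(nillog_iter N k) /nillog_step; apply: commrB => //.
apply: commrB => //; apply: commrB; last exact: commr1.
exact: comm_exp_psum.
Qed.

Lemma nilexp_tail_ex k N : ltrig k N -> exists2 Q, nilexp N = 1 + N + Q & ltrig (k * 2) Q.
Proof.
move=> h; exists (nilexp N - 1 - N); last exact: nilexp_tail.
by rewrite -[X in _ = _ + X]addrA -opprD [RHS]addrC subrK.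
Qed.

(** Since [L] and [X] commute, [nilexp (L - X)] is [E * (1 - X + Q)] with [E = nilexp L] and [Q] of
    twice the depth of [X]. The new error is [- (E - 1) * X + E * Q]: the factor [E - 1] deepens the
    first term by one diagonal, and [Q] is already deep enough. *)
Lemma nillog_stepP k N L X : GRing.comm L N -> ltrig 1 L -> nilexp L = 1 + N + X ->
  ltrig k.+1 X -> ltrig 1 (L - X) /\ ltrig k.+2 (nilexp (L - X) - 1 - N).
Proof.
move=> cLN L1 XE X1.
have cLX : GRing.comm L X.
  have -> : X = nilexp L - (1 + N) by rewrite XE [1 + N + X]addrC addrK.
  apply: commrB; last by apply: commrD => //; exact: commr1.
  by apply: comm_exp_psum; exact: commr_refl.
have X0 : ltrig 1 X by exact: ltrigW X1.
split; first exact: ltrigB.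
rewrite nilexpD //; [|exact: commrN|exact: ltrigN].
have [Q -> Q2] := nilexp_tail_ex (ltrigN X1).
have Qs : ltrig k.+2 Q.
  by apply: ltrigW Q2; rewrite muln2 doubleS !ltnS -addnn leq_addr.
have E1 := nilexp_sub1 L1; move: (nilexp L) XE E1 => E XE E1.
have -> : E * (1 - X + Q) - 1 - N = - ((E - 1) * X) + E * Q.
  rewrite mulrDr mulrBr mulr1 mulrBl mul1r opprB -addrA -opprD addrAC.
  by congr (_ + _); rewrite addrAC {1}XE [1 + N + X]addrC addrK.
apply: ltrigD; first by apply: ltrigN; rewrite -add1n; apply: ltrigM.
rewrite -[k.+2]add0n; apply: ltrigM => //.
by rewrite -[E](subrK 1); apply: ltrigD; [exact: ltrigW E1|exact: ltrig1].
Qed.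

Lemma nillog_iterP N k : ltrig 1 N ->
  ltrig 1 (nillog_iter N k) /\ ltrig k.+1 (nilexp (nillog_iter N k) - 1 - N).
Proof.
move=> N1; elim: k => [|k [IH1 IH2]].
  split; first exact: ltrig0.
  by rewrite /nillog_iter /= nilexp0 subrr sub0r; exact: ltrigN.
apply: nillog_stepP => //; first by apply: commr_sym; apply: comm_nillog_iter;
  exact: commr_refl.
by rewrite -[X in _ = _ + X]addrA -opprD [RHS]addrC subrK.
Qed.

Lemma nillogK N : ltrig 1 N -> nilexp (nillog N) = 1 + N.
Proof.
move=> /(nillog_iterP n.+1) [_ h]; apply/eqP; rewrite -subr_eq0 opprD addrA.
by apply/eqP; apply: ltrig_eq0 h.
Qed.

Lemma ltrig_nillog N : ltrig 1 N -> ltrig 1 (nillog N).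
Proof. by move=> /(nillog_iterP n.+1) []. Qed.

Lemma expR_near0 (eps : R) : 0 < eps ->
  exists2 d : R, 0 < d & forall t, 0 <= t < d -> expR t - 1 < eps.
Proof.
move=> e0; have /cvgrPdist_lt /(_ eps e0) /nbhs_ballP [d /= d0 h] := @continuous_expR R 0.
exists d => // t /andP[t0 td].
have := h t; rewrite /ball /= sub0r normrN ger0_norm // expR0 => /(_ td).
by rewrite distrC; apply: le_lt_trans; exact: ler_norm.
Qed.

(** The next iterate is bounded by the sum of the norms of [L], [nilexp L - 1] and [N], each kept
    below a third of [eps]. *)
Lemma nillog_iter_near0 k (eps : R) : 0 < eps ->
  exists2 d : R, 0 < d & forall N, ltrig 1 N -> l1norm N < d ->
    l1norm (nillog_iter N k) < eps.
Proof.
elim: k eps => [|k IH] eps e0.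
  by exists 1 => // N _ _; rewrite l1norm0.
have e3 : 0 < eps / 3 by rewrite divr_gt0.
have [d1 d10 h1] := expR_near0 e3.
have m0 : 0 < Num.min (eps / 3) d1 by rewrite lt_min e3.
have [d2 d20 h2] := IH _ m0.
exists (Num.min (eps / 3) d2); first by rewrite lt_min e3.
move=> N Ns; rewrite lt_min => /andP[N3 N2].
have [L1 _] := nillog_iterP k Ns.
rewrite /nillog_iter /= -/(nillog_iter N k); set L := nillog_iter N k in L1 *.
have := h2 _ Ns N2; rewrite -/L lt_min => /andP[L3 Ld].
rewrite /nillog_step; apply: le_lt_trans (l1normB _ _) _.
have := l1normB (nilexp L - 1) N; have := expmx_to_near1 (expmx_to_nilexp L1).
have := h1 (l1norm L); rewrite l1norm_ge0 Ld => /(_ isT).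
lra.
Qed.

End Nilpotent.

(** * Exponential and logarithm on K *)

Section BlockTriangular.
Context {R : realType} {n : nat} {T : eqType} (b : 'I_n.+1 -> T).
Local Notation C := R[i].
Local Notation M := 'M[C]_n.+1.
Implicit Types A B X : M.

(** The algebra [KK] entry by entry, with [b] sending an index to the label of its block; [KK_btrig]
    makes the link. No cast between block sizes enters the matrix calculus. *)
Definition btrig A : Prop :=
  [/\ ltrig 0 A, forall i j, b i != b j -> A i j = 0
    & forall i j, b i = b j -> A i i = A j j].

Lemma btrig0 : btrig 0.
Proof.
by split; [exact: ltrig0|move=> i j _; rewrite mxE|move=> i j _; rewrite !mxE].
Qed.

Lemma btrig_diag (d : 'rV[C]_n.+1) :
  (forall i j, b i = b j -> d 0 i = d 0 j) -> btrig (diag_mx d).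
Proof.
move=> h; split.
- move=> i j; rewrite addn0 mxE => ij; case: eqVneq ij => [->|_ _]; first by rewrite ltnn.
  by rewrite mulr0n.
- by move=> i j; rewrite mxE; case: (eqVneq i j) => [->|_ _]; rewrite ?eqxx // mulr0n.
- by move=> i j ij; rewrite !mxE !eqxx (h _ _ ij).
Qed.

Lemma btrig1 : btrig 1.
Proof.
by rewrite -[1]/(1%:M) -diag_const_mx; apply: btrig_diag => i j _; rewrite !mxE.
Qed.

Lemma btrigD A B : btrig A -> btrig B -> btrig (A + B).
Proof.
case=> a1 a2 a3 [b1 b2 b3]; split; first exact: ltrigD.
  by move=> i j ij; rewrite mxE a2 // b2 // addr0.
by move=> i j ij; rewrite !mxE (a3 i j) // (b3 i j).
Qed.

Lemma btrigZ c A : btrig A -> btrig (c *: A).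
Proof.
case=> a1 a2 a3; split; first exact: ltrigZ.
  by move=> i j ij; rewrite mxE a2 // mulr0.
by move=> i j ij; rewrite !mxE (a3 i j).
Qed.

Lemma btrigN A : btrig A -> btrig (- A).
Proof. by rewrite -scaleN1r; exact: btrigZ. Qed.

Lemma btrigB A B : btrig A -> btrig B -> btrig (A - B).
Proof. by move=> a h; apply: btrigD => //; exact: btrigN. Qed.

Lemma ltrig0_mul_diag A B i : ltrig 0 A -> ltrig 0 B -> (A * B) i i = A i i * B i i.
Proof.
move=> a h; rewrite mxE (bigD1 i) //= big1 ?addr0 // => k ki.
have [ik|ki'] := ltnP i k; first by rewrite a ?mul0r // addn0.
by rewrite h ?mulr0 // addn0 ltn_neqAle ki' andbT.
Qed.

Lemma btrigM A B : btrig A -> btrig B -> btrig (A * B).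
Proof.
case=> a1 a2 a3 [b1 b2 b3]; split.
- by rewrite -[0%N]/(0 + 0)%N; exact: ltrigM.
- move=> i j ij; rewrite mxE big1 // => k _.
  have [ik|ik] := eqVneq (b i) (b k); last by rewrite a2 // mul0r.
  by rewrite b2 ?mulr0 // -ik.
- by move=> i j ij; rewrite !ltrig0_mul_diag // (a3 i j) // (b3 i j).
Qed.

Lemma btrigX A k : btrig A -> btrig (A ^+ k).
Proof. by move=> a; elim: k => [|k IH]; [exact: btrig1|rewrite exprS; exact: btrigM]. Qed.

Lemma btrig_sum (I : Type) (s : seq I) (Q : pred I) (F : I -> M) :
  (forall i, Q i -> btrig (F i)) -> btrig (\sum_(i <- s | Q i) F i).
Proof.
by move=> h; elim/big_rec : _ => [|i x Qi]; [exact: btrig0|apply: btrigD; exact: h].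
Qed.

Lemma btrig_exp_psum K A : btrig A -> btrig (exp_psum K A).
Proof. by move=> a; apply: btrig_sum => k _; apply: btrigZ; exact: btrigX. Qed.

Lemma btrig_nillog_iter A k : btrig A -> btrig (nillog_iter A k).
Proof.
move=> a; elim: k => [|k IH]; first exact: btrig0.
apply: btrigB => //; apply: btrigB => //; apply: btrigB; last exact: btrig1.
exact: btrig_exp_psum.
Qed.

Definition mxdiagonal A : M := diag_mx (\row_i A i i).

Lemma btrig_mxdiagonal A : btrig A -> btrig (mxdiagonal A).
Proof. by case=> _ _ a; apply: btrig_diag => i j ij; rewrite !mxE (a i j). Qed.

Lemma ltrig_sub_mxdiagonal A : ltrig 0 A -> ltrig 1 (A - mxdiagonal A).
Proof.
move=> a i j; rewrite addn1 ltnS leq_eqVlt => /orP[/eqP/val_inj ->|ij].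
  by rewrite !mxE eqxx mulr1n subrr.
rewrite !mxE (a i j) ?addn0 // add0r; case: (eqVneq i j) ij => [->|_ _].
  by rewrite ltnn.
by rewrite mulr0n oppr0.
Qed.

(** A diagonal matrix that is constant on blocks is scalar on each block, hence commutes with all
    block-diagonal matrices. *)
Lemma comm_btrig_diag A (d : 'rV[C]_n.+1) : btrig A ->
  (forall i j, b i = b j -> d 0 i = d 0 j) -> GRing.comm A (diag_mx d).
Proof.
case=> _ a _ h; rewrite /GRing.comm -[LHS]/(_ *m _) -[RHS]/(_ *m _).
rewrite mul_mx_diag mul_diag_mx; apply/matrixP => i j; rewrite !mxE.
have [ij|ij] := eqVneq (b i) (b j); first by rewrite (h i j) // mulrC.
by rewrite a // mul0r mulr0.
Qed.

Lemma comm_btrig_mxdiagonal A B : btrig A -> btrig B -> GRing.comm A (mxdiagonal B).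
Proof.
by move=> a [_ _ h]; apply: comm_btrig_diag => // i j ij; rewrite !mxE (h i j).
Qed.

Definition cexp_diag A : M := diag_mx (\row_i cexp (A i i)).

Lemma expmx_to_btrig A : btrig A -> expmx_to A (cexp_diag A * nilexp (A - mxdiagonal A)).
Proof.
move=> a; have [a1 _ _] := a.
rewrite -[X in expmx_to X _](subrK (mxdiagonal A)) addrC; apply: expmx_to_add.
- apply: commr_sym; apply: comm_btrig_mxdiagonal => //.
  by apply: btrigB => //; exact: btrig_mxdiagonal.
- have := expmx_to_diag_cexp (\row_i A i i); congr (expmx_to _ (diag_mx _)).
  by apply/rowP => i; rewrite !mxE.
- by apply: expmx_to_nilexp; exact: ltrig_sub_mxdiagonal.
Qed.

Lemma expmx_btrigE A : btrig A -> expmx A = cexp_diag A * nilexp (A - mxdiagonal A).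
Proof. by move=> /expmx_to_btrig/expmx_to_expmx. Qed.

Lemma expmx_to_expmx_btrig A : btrig A -> expmx_to A (expmx A).
Proof. by move=> a; rewrite expmx_btrigE //; exact: expmx_to_btrig. Qed.

Lemma expmxD_btrig A B : btrig A -> btrig B -> GRing.comm A B ->
  expmx (A + B) = expmx A * expmx B.
Proof.
by move=> a h cAB; apply: expmx_to_expmx; apply: expmx_to_add => //;
  exact: expmx_to_expmx_btrig.
Qed.

Lemma expmx0 : expmx (0 : M) = 1.
Proof. by rewrite (expmx_to_expmx (expmx_to_nilexp (@ltrig0 R n 1))) nilexp0. Qed.

Lemma expmxN_btrig A : btrig A -> expmx A * expmx (- A) = 1.
Proof.
move=> a; rewrite -expmxD_btrig ?subrr ?expmx0 //; first exact: btrigN.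
by apply: commrN; exact: commr_refl.
Qed.

Lemma btrig_cexp_diag A : btrig A -> btrig (cexp_diag A).
Proof. by case=> _ _ a; apply: btrig_diag => i j ij; rewrite !mxE (a i j). Qed.

Lemma btrig_expmx A : btrig A -> btrig (expmx A).
Proof.
move=> a; rewrite expmx_btrigE //; apply: btrigM; first exact: btrig_cexp_diag.
by apply: btrig_exp_psum; apply: btrigB => //; exact: btrig_mxdiagonal.
Qed.

Lemma expmx_diag A i : btrig A -> (expmx A) i i = cexp (A i i).
Proof.
move=> a; have [a1 _ _] := a; rewrite expmx_btrigE // ltrig0_mul_diag.
- have := nilexp_sub1 (ltrig_sub_mxdiagonal a1) (i := i) (j := i).
  rewrite addn1 ltnS leqnn => /(_ isT)/eqP; rewrite mxE [X in _ + X]mxE subr_eq0.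
  by rewrite [(1 : M) i i]mxE eqxx => /eqP ->; rewrite mulr1 !mxE eqxx mulr1n.
- by have [] := btrig_cexp_diag a.
- by have [] := btrig_exp_psum n.+2 (btrigB a (btrig_mxdiagonal a)).
Qed.

Lemma cexp_diagK A : cexp_diag A * diag_mx (\row_i (cexp (A i i))^-1) = 1.
Proof.
rewrite -[_ * _]/(_ *m _) mulmx_diag -[RHS]/(1%:M) -diag_const_mx; congr diag_mx.
by apply/rowP => i; rewrite !mxE divff // cexp_neq0.
Qed.

(* A commutes with the diagonal part of B, hence with its exponential; so it
   commutes with the exponential of the nilpotent part of B. *)
Lemma comm_expmx_btrig A B : btrig A -> btrig B -> GRing.comm A (expmx B) ->
  GRing.comm A B.
Proof.
move=> a h cAB; have [a1 _ _] := a; have [h1 _ h3] := h.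
rewrite -[B](subrK (mxdiagonal B)); apply: commrD; last exact: comm_btrig_mxdiagonal.
apply: comm_nilexp => //; first exact: ltrig_sub_mxdiagonal.
set D := diag_mx (\row_i (cexp (B i i))^-1).
have -> : nilexp (B - mxdiagonal B) = D * expmx B.
  rewrite expmx_btrigE // mulrA (_ : D * _ = 1) ?mul1r // -(cexp_diagK B).
  by rewrite -[LHS]/(_ *m _) -[RHS]/(_ *m _) diag_mxC.
by apply: commrM => //; apply: comm_btrig_diag => // i j ij; rewrite !mxE (h3 i j).
Qed.

Lemma comm_expmx A X : btrig A -> btrig X -> GRing.comm X A -> GRing.comm X (expmx A).
Proof.
move=> a x cXA; have [_ _ a3] := a; rewrite expmx_btrigE //; apply: commrM.
  by apply: comm_btrig_diag => // i j ij; rewrite !mxE (a3 i j).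
by apply: comm_exp_psum; apply: commrB => //; exact: comm_btrig_mxdiagonal.
Qed.

(** The nilpotent [N] in the factorization [A = D * (1 + N)], where [D] is the diagonal of [A],
    assumed invertible. *)
Definition unitpart A : M := diag_mx (\row_i (A i i)^-1) * A - 1.
Definition logmx A : M := diag_mx (\row_i clog (A i i)) + nillog (unitpart A).

Lemma btrig_unitpart A : btrig A -> btrig (unitpart A).
Proof.
move=> a; apply: btrigB; last exact: btrig1; apply: btrigM => //.
by case: a => _ _ a3; apply: btrig_diag => i j ij; rewrite !mxE (a3 i j).
Qed.

Lemma ltrig_unitpart A : btrig A -> (forall i, A i i != 0) -> ltrig 1 (unitpart A).
Proof.
move=> a nz; have [a1 _ _] := btrig_unitpart a => i j.
rewrite addn1 ltnS leq_eqVlt => /orP[/eqP/val_inj ->|ij]; last by rewrite a1 ?addn0.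
rewrite /unitpart -[_ * A]/(_ *m _) mul_diag_mx !mxE eqxx mulVf //.
by rewrite subrr.
Qed.

Lemma btrig_logmx A : btrig A -> btrig (logmx A).
Proof.
move=> a; apply: btrigD; last by apply: btrig_nillog_iter; exact: btrig_unitpart.
by case: a => _ _ a3; apply: btrig_diag => i j ij; rewrite !mxE (a3 i j).
Qed.

Lemma logmx_diag A i : btrig A -> (forall i, A i i != 0) -> (logmx A) i i = clog (A i i).
Proof.
move=> a nz; have h := ltrig_nillog (ltrig_unitpart a nz).
by rewrite /logmx mxE [X in _ + X](h i i) ?addn1 // !mxE eqxx addr0.
Qed.

Lemma logmxK A : btrig A -> (forall i, A i i != 0) -> expmx (logmx A) = A.
Proof.
move=> a nz; have [_ _ a3] := a; have u := ltrig_unitpart a nz.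
apply: expmx_to_expmx; pose v : 'rV[C]_n.+1 := \row_i clog (A i i).
have -> : expmx_to (logmx A) A =
   expmx_to (diag_mx v + nillog (unitpart A)) (diag_mx (\row_i cexp (v 0 i)) * nilexp (nillog (unitpart A))).
  congr expmx_to; rewrite nillogK // /unitpart addrC subrK mulrA.
  rewrite (_ : diag_mx _ * diag_mx _ = 1) ?mul1r //.
  rewrite -[_ * _]/(_ *m _) mulmx_diag -[RHS]/(1%:M) -diag_const_mx; congr diag_mx.
  by apply/rowP => i; rewrite !mxE clogK // divff.
apply: expmx_to_add.
- apply: commr_sym; apply: comm_btrig_diag;
  first exact: btrig_nillog_iter (btrig_unitpart a).
  by move=> i j ij; rewrite !mxE (a3 i j).
- exact: expmx_to_diag_cexp.
- by apply: expmx_to_nilexp; exact: ltrig_nillog.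
Qed.

End BlockTriangular.

(** * Continuity of the logarithm at the identity *)

Section LogNear1.
Context {R : realType} {n : nat} {T : eqType} (b : 'I_n.+1 -> T).
Local Notation C := R[i].
Local Notation M := 'M[C]_n.+1.

Lemma l1norm_strict_le (A : M) : l1norm (A - mxdiagonal A) <= l1norm (A - 1).
Proof.
apply: ler_sum => i _; apply: ler_sum => j _; rewrite !mxE.
have [->|ij] := eqVneq i j; last by rewrite !mulr0n.
by rewrite !mulr1n subrr normc0 normc_ge0.
Qed.

Lemma logmx_near1 (eps : R) : 0 < eps ->
  exists2 d : R, 0 < d & forall B : M, btrig b B -> l1norm (B - 1) < d ->
    (forall i, B i i != 0) /\ l1norm (logmx B) < eps.
Proof.
move=> e0; pose m : R := n.+1%:R.
have m0 : 0 < m by rewrite ltr0n.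
have e1 : 0 < eps / 2 / m by rewrite !divr_gt0.
have [d1 d10 h1] := clog_near1 e1.
have e2 : 0 < eps / 2 by rewrite divr_gt0.
have [d2 d20 h2] := @nillog_iter_near0 R n n.+1 _ e2.
(* [d1] makes [clog] small at each of the [m] diagonal entries. The bound [2^-1] keeps these entries
   above one half in modulus, so the inverse of the diagonal has norm at most [2 * m], and the last
   bound then brings [unitpart B] below [d2]. *)
exists (Num.min (Num.min d1 (2^-1)) (d2 / (2 * m))).
  by rewrite !lt_min d10 invr_gt0 ltr0n divr_gt0 ?mulr_gt0.
move=> B KB; rewrite !lt_min -andbA => /and3P[B1 B2 B3].
have ent i : normc (B i i - 1) <= l1norm (B - 1).
  by have := l1norm_entry (B - 1) i i; rewrite !mxE eqxx mulr1n.
have half i : 2^-1 < normc (B i i).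
  have := le_normcD (1 - B i i) (B i i); rewrite subrK (normc1 R).
  rewrite -(normcN (1 - _)) opprB => h; have := ent i; move: B2.
  by move: (l1norm _) (normc _) (normc _) h => x y z; lra.
have nz i : B i i != 0.
  by apply: contraTneq (half i) => ->; rewrite normc0 -leNgt invr_ge0 ler0n.
split => //; rewrite /logmx; apply: le_lt_trans (l1normD _ _) _.
rewrite -(divfK (lt0r_neq0 (ltr0Sn R 1)) eps) mulr_natr mulr2n.
apply: ltrD.
  rewrite l1norm_diag; have -> : eps / 2 = \sum_(i < n.+1) (eps / 2 / m).
    by rewrite sumr_const card_ord -[RHS]mulr_natr divfK // gt_eqF.
  apply: ltr_sum => [|i _]; first by apply/hasP; exists ord0; rewrite // mem_index_enum.
  by rewrite mxE; apply: h1; exact: le_lt_trans (ent i) B1.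
apply: h2; first exact: ltrig_unitpart KB nz.
have -> : unitpart B = diag_mx (\row_i (B i i)^-1) * (B - mxdiagonal B).
  rewrite mulrBr /unitpart; congr (_ - _).
  rewrite -[RHS]/(_ *m _) mulmx_diag -[LHS]/(1%:M) -diag_const_mx; congr diag_mx.
  by apply/rowP => i; rewrite !mxE mulVf.
apply: le_lt_trans (l1normM _ _) _.
move: B3; rewrite ltr_pdivlMr ?mulr_gt0 // mulrC; apply: le_lt_trans.
apply: ler_pM; rewrite ?l1norm_ge0 ?l1norm_strict_le //.
rewrite l1norm_diag; have -> : 2 * m = \sum_(i < n.+1) 2.
  by rewrite sumr_const card_ord mulr_natr.
apply: ler_sum => i _; rewrite mxE normcV.
by rewrite -[leRHS]invrK lef_pV2 ?posrE ?invr_gt0 ?normc_gt0 // ltW.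
Qed.

End LogNear1.

(** * The double centralizer *)

Section Core.
Context {R : realType} {n : nat} {T : eqType} (b : 'I_n.+1 -> T).
Local Notation C := R[i].
Local Notation M := 'M[C]_n.+1.
Variables (G : set M) (u0 : 'cV[C]_n.+1).
Hypothesis GK : forall g, G g -> btrig b g.
Hypothesis G1 : G 1.
Hypothesis GM : forall g h, G g -> G h -> G (g * h).
Hypothesis GV : forall g, G g -> exists2 h, G h & g * h = 1.
Hypothesis Gab : forall g h, G g -> G h -> GRing.comm g h.
Hypothesis G00 : forall g, G g -> g 0 0 = 1.
Hypothesis u00 : u0 0 0 = 1.
(** The index [i'] is the first one of the block of [i]; there a vector [A *m u] shows the diagonal
    entry of [A] on that block. *)
Hypothesis lead : forall i, exists i', [/\ b i' = b i, u0 i' 0 = 1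
  & forall j : 'I_n.+1, (j < i')%N -> b j != b i'].

(** The conjugate by [P] of the set [rmg]: for a lower triangular matrix, a zero corner entry means
    a zero first row, which is membership in [calF]. *)
Definition log_preimage : set M := [set X | [/\ btrig b X, X 0 0 = 0 & G (expmx X)]].

(** The commutative algebra V of the overview. *)
Definition bicomm : set M :=
  [set A | btrig b A /\ forall X, btrig b X -> (forall g, G g -> GRing.comm X g) ->
           GRing.comm X A].

(** Density inside the hyperplane of first coordinate [c]: 1 for the group, 0 for its logarithms. *)
Definition affdense (c : C) (S : set M) (u : 'cV[C]_n.+1) : Prop :=
  forall y : 'cV[C]_n.+1, y 0 0 = c -> forall eps : R, 0 < eps ->
    exists2 A, S A & l1norm (A *m u - y) < eps.

Lemma bicomm_G g : G g -> bicomm g.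
Proof. by move=> Gg; split => [|X _]; [exact: GK|exact]. Qed.

(** As [G] is abelian, it lies in its own centralizer; so [A] commutes with [G], and [B] commutes
    with whatever in K does. *)
Lemma bicomm_comm A B : bicomm A -> bicomm B -> GRing.comm A B.
Proof.
move=> [KA hA] [KB hB]; apply: hB => // g Gg; apply: commr_sym; apply: hA => //.
  exact: GK.
by move=> h Gh; exact: Gab.
Qed.

Lemma bicommZ c A : bicomm A -> bicomm (c *: A).
Proof.
by move=> [KA hA]; split => [|X KX hX]; [exact: btrigZ|apply: commrZ; exact: hA].
Qed.

Lemma bicommD A B : bicomm A -> bicomm B -> bicomm (A + B).
Proof.
move=> [KA hA] [KB hB]; split => [|X KX hX]; first exact: btrigD.
by apply: commrD; [exact: hA|exact: hB].
Qed.

Lemma bicommB A B : bicomm A -> bicomm B -> bicomm (A - B).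
Proof. by move=> hA hB; apply: bicommD => //; rewrite -scaleN1r; exact: bicommZ. Qed.

Lemma bicommM A B : bicomm A -> bicomm B -> bicomm (A * B).
Proof.
move=> [KA hA] [KB hB]; split => [|X KX hX]; first exact: btrigM.
by apply: commrM; [exact: hA|exact: hB].
Qed.

Lemma bicomm1 : bicomm 1. Proof. exact: bicomm_G. Qed.

Lemma bicomm_sum (I : finType) (F : I -> M) :
  (forall i, bicomm (F i)) -> bicomm (\sum_i F i).
Proof.
move=> h; elim/big_rec : _ => [|i x _]; last exact: bicommD.
by rewrite -(subrr (1 : M)); apply: bicommB; exact: bicomm1.
Qed.

Lemma bicomm_expmx A : bicomm A -> bicomm (expmx A).
Proof.
move=> [KA hA]; split => [|X KX hX]; first exact: btrig_expmx.
by apply: (comm_expmx KA) => //; exact: hA.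
Qed.

(** What centralizes [G] commutes with [expmx A], hence with [A] by [comm_expmx_btrig]. *)
Lemma bicomm_log A : btrig b A -> bicomm (expmx A) -> bicomm A.
Proof.
move=> KA [_ hA]; split => // X KX hX.
by apply: (comm_expmx_btrig KX KA); exact: hA.
Qed.

Lemma bicomm_log_preimage X : log_preimage X -> bicomm X.
Proof. by case=> KX _ GX; apply: bicomm_log => //; exact: bicomm_G. Qed.

Lemma log_preimage0 : log_preimage 0.
Proof. by split; [exact: btrig0|rewrite mxE|rewrite expmx0]. Qed.

(** Logarithms of elements of [G] all lie in [bicomm], so they commute and the exponential of their
    difference is a quotient in [G]. This is the additive half of (iii). *)
Lemma log_preimageB X Y : log_preimage X -> log_preimage Y -> log_preimage (X - Y).
Proof.
move=> lX lY; have [KX X0 GX] := lX; have [KY Y0 GY] := lY.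
split; [exact: btrigB|by rewrite !mxE X0 Y0 subr0|].
rewrite (expmxD_btrig KX (btrigN KY)); last first.
  by apply: commrN; apply: bicomm_comm; exact: bicomm_log_preimage.
have [h Gh hY] := GV GY; rewrite (_ : expmx (- Y) = h); first exact: GM.
have := expmxN_btrig (btrigN KY); rewrite opprK => e.
by rewrite -[LHS]mulr1 -hY mulrA e mul1r.
Qed.

Lemma near1_unitmx (X : M) : l1norm (X - 1) < 1 -> X \in unitmx.
Proof.
move=> X1; rewrite unitmxE unitfE; apply/det0P => -[v v0 vX].
have vE : v = v *m (1 - X) by rewrite mulmxBr vX mulmx1 subr0.
have : l1norm v <= l1norm v * l1norm (X - 1) by rewrite l1normBC {1}vE l1normM.
rewrite leNgt => /negP; apply; rewrite gtr_pMr // lt_neqAle l1norm_ge0 andbT.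
by apply: contra v0 => /eqP v0; apply/eqP/l1norm_eq0; rewrite -v0.
Qed.

Lemma mul_inv_sub (E E' g : M) (u : 'cV[C]_n.+1) : E' * E = 1 ->
  (E' * g - 1) *m u = E' *m (g *m u - E *m u).
Proof. by move=> <-; rewrite mulmxBl mulmxBr -!mulmxA. Qed.

(** * Cyclic vectors of the double centralizer *)

Definition cyclic_vec (u : 'cV[C]_n.+1) := forall y, exists2 A, bicomm A & A *m u = y.

(* The vectors A k u form a matrix close to the identity, hence invertible. *)
Lemma cyclic_of_approx (u : 'cV[C]_n.+1) :
  (forall (y : 'cV_n.+1) (eps : R), 0 < eps -> exists2 A, bicomm A &
    l1norm (A *m u - y) < eps) ->
  cyclic_vec u.
Proof.
move=> h y; pose eps : R := (n.+1%:R)^-1.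
have e0 : 0 < eps by rewrite invr_gt0 ltr0n.
have /choice[A hA] : forall k : 'I_n.+1, exists A,
  bicomm A /\ l1norm (A *m u - delta_mx k 0) < eps.
  by move=> k; have [A ? ?] := h (delta_mx k 0) _ e0; exists A.
pose Y : M := \matrix_(i, j) (A j *m u) i 0.
have uY : Y \in unitmx.
  apply: near1_unitmx; rewrite /l1norm exchange_big /=.
  apply: (@lt_le_trans _ _ (\sum_(j < n.+1) eps)); last first.
    by rewrite sumr_const card_ord -[leLHS]mulr_natr mulVf // pnatr_eq0.
  apply: ltr_sum => [|k _]; first by apply/hasP; exists ord0; rewrite // mem_index_enum.
  apply: le_lt_trans (hA k).2; rewrite /l1norm; apply: ler_sum => i _.
  by rewrite big_ord1 !mxE eqxx andbT.
pose z := invmx Y *m y.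
exists (\sum_j z j 0 *: A j); first by apply: bicomm_sum => j; apply: bicommZ;
  exact: (hA j).1.
rewrite -[RHS](mulKVmx uY) -/z mulmx_suml; apply/colP => i; rewrite summxE [RHS]mxE.
by apply: eq_bigr => j _; rewrite -scalemxAl [LHS]mxE [in RHS]mxE mulrC.
Qed.

(* If s k maps u to the k-th basis vector, the k-th column of D is s k (D u). *)
Lemma bicomm_bound u : cyclic_vec u ->
  exists2 c : R, 0 < c & forall D, bicomm D -> l1norm D <= c * l1norm (D *m u).
Proof.
move=> cu.
have /choice[s hs] : forall k : 'I_n.+1, exists A, bicomm A /\ A *m u = delta_mx k 0.
  by move=> k; have [A ? ?] := cu (delta_mx k 0); exists A.
exists (\sum_k l1norm (s k) + 1).
  by rewrite ltr_wpDl // sumr_ge0 // => k _; exact: l1norm_ge0.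
move=> D VD; rewrite mulrDl mul1r; apply: (@le_trans _ _ (\sum_k l1norm (s k *m (D *m u)))).
  rewrite /l1norm exchange_big /=; apply: ler_sum => k _; apply: ler_sum => i _.
  have [Vs sE] := hs k.
  rewrite big_ord1 mulmxA (_ : s k *m D = D *m s k); last exact: bicomm_comm.
  by rewrite -mulmxA sE -colE mxE.
rewrite -[leLHS]addr0 lerD ?l1norm_ge0 // mulr_suml; apply: ler_sum => k _;
  exact: l1normM.
Qed.

(** In row [i], entries to the right vanish by triangularity and entries to the left belong to other
    blocks. *)
Lemma lead_entry (A : M) (u : 'cV[C]_n.+1) (i : 'I_n.+1) : btrig b A ->
  (forall j : 'I_n.+1, (j < i)%N -> b j != b i) -> (A *m u) i 0 = A i i * u i 0.
Proof.
move=> [a1 a2 _] hi; rewrite mxE (bigD1 i) //= big1 ?addr0 // => j ji.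
have [ij|] := ltnP i j; first by rewrite a1 ?addn0 // mul0r.
by rewrite leq_eqVlt val_eqE (negbTE ji) /= => /hi; rewrite eq_sym => /a2 ->;
  rewrite mul0r.
Qed.

Lemma entry00 (A : M) (u : 'cV[C]_n.+1) : btrig b A -> (A *m u) 0 0 = A 0 0 * u 0 0.
Proof. by move=> KA; apply: lead_entry. Qed.

Lemma diag_neq0 (A : M) (u : 'cV[C]_n.+1) : btrig b A -> (forall i, u0 i 0 != 0 ->
  (A *m u) i 0 != 0) ->
  forall i, A i i != 0.
Proof.
move=> KA h i; have [i' [bi ui hi]] := lead i; have [_ _ a3] := KA.
rewrite -(a3 _ _ bi); have := h i'; rewrite ui oner_eq0 => /(_ isT).
by rewrite (lead_entry _ KA hi) mulf_eq0 negb_or => /andP[].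
Qed.

Lemma cyclic_of_affdense1 u : affdense 1 G u -> cyclic_vec u.
Proof.
move=> du; apply: cyclic_of_approx => y eps e0.
(* A vector [y] of first coordinate [c] is [y + (1 - c) *: e] plus [(c - 1) *: e], a combination of
   two vectors of first coordinate 1, each within reach of [G]. The number [k] absorbs the
   coefficient of the second error. *)
pose e : 'cV[C]_n.+1 := delta_mx 0 0; pose c := y 0 0.
pose k : R := normc (c - 1) + 1.
have k0 : 0 < k by rewrite ltr_wpDl // normc_ge0.
have e2 : 0 < eps / 2 by rewrite divr_gt0.
have e2k : 0 < eps / 2 / k by rewrite divr_gt0.
have y1 : (y + (1 - c) *: e) 0 0 = 1.
  by rewrite !mxE !eqxx mulr1 -/c addrC subrK.
have e1 : e 0 0 = 1 by rewrite mxE !eqxx.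
have [g1 Gg1 h1] := du _ y1 _ e2; have [g2 Gg2 h2] := du _ e1 _ e2k.
exists (g1 + (c - 1) *: g2).
  by apply: bicommD; [|apply: bicommZ]; exact: bicomm_G.
have -> : (g1 + (c - 1) *: g2) *m u - y =
   (g1 *m u - (y + (1 - c) *: e)) + (c - 1) *: (g2 *m u - e).
  rewrite mulmxDl -scalemxAl scalerBr -(opprB c 1) scaleNr.
  move: (g1 *m u) (_ *: (g2 *m u)) (_ *: e) => p q s.
  by rewrite opprB -[RHS]addrA [s - y + _]addrC [q - s + _]addrA subrK addrA.
rewrite (splitr eps) (le_lt_trans (l1normD _ _)) // ltrD // l1normZ.
move: h2; rewrite ltr_pdivlMr // mulrC; apply: le_lt_trans.
by rewrite ler_wpM2r ?l1norm_ge0 // lerDl.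
Qed.

Lemma cyclic_of_affdense0 : affdense 0 log_preimage u0 -> cyclic_vec u0.
Proof.
move=> du; apply: cyclic_of_approx => y eps e0.
have y0 : (y - y 0 0 *: u0) 0 0 = 0 by rewrite !mxE u00 mulr1 subrr.
(* A scalar matrix corrects the first coordinate, since that of [u0] is 1. *)
have [X lX h] := du _ y0 _ e0; exists (y 0 0 *: 1 + X).
  by apply: bicommD; [apply: bicommZ; exact: bicomm1|exact: bicomm_log_preimage].
have -> : (y 0 0 *: 1 + X) *m u0 - y = X *m u0 - (y - y 0 0 *: u0).
  by rewrite mulmxDl -scalemxAl mul1mx opprB -addrA addrCA.
by [].
Qed.

(** * Transport of density to [u0], and between the group and its logarithms *)

Lemma affdense1_u0 (u : 'cV[C]_n.+1) : u 0 0 = 1 -> affdense 1 G u -> affdense 1 G u0.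
Proof.
move=> u1 du; have cu := cyclic_of_affdense1 du.
have [A VA Au] := cu u0; have [KA _] := VA.
have nzA : forall i, A i i != 0 by apply: (@diag_neq0 _ u) => // i; rewrite Au.
have A00 : A 0 0 = 1.
  by have := entry00 u KA; rewrite Au u1 mulr1 u00.
(* With a nonzero diagonal [A] is an exponential, and the opposite of its logarithm gives the
   inverse. *)
have [B AB] : exists B, A *m B = 1%:M.
  by exists (expmx (- logmx A)); have := expmxN_btrig (btrig_logmx KA);
    rewrite (logmxK KA nzA).
move=> y y1 eps e0; pose k : R := l1norm A + 1.
have k0 : 0 < k by rewrite ltr_wpDl // l1norm_ge0.
have ek : 0 < eps / k by rewrite divr_gt0.
have By : (B *m y) 0 0 = 1.
  by have := entry00 (B *m y) KA; rewrite mulmxA AB mul1mx A00 mul1r y1 => <-.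
have [g Gg hg] := du _ By _ ek.
  exists g => //.
  have -> : g *m u0 - y = A *m (g *m u - B *m y).
    rewrite mulmxBr !mulmxA AB mul1mx -Au mulmxA; congr (_ *m _ - _).
    by apply: bicomm_comm => //; exact: bicomm_G.
  apply: le_lt_trans (l1normM _ _) _.
  move: hg; rewrite ltr_pdivlMr // mulrC; apply: le_lt_trans.
  by rewrite ler_wpM2r ?l1norm_ge0 // lerDl.
Qed.

(** Choose [X] in [bicomm] with [X *m u0 = y], and [g] in [G] with [g *m u0] close to
    [expmx X *m u0]. By [bicomm_bound] the matrix [B = expmx (- X) * g] is close to 1, so its
    logarithm [L] is small; [X + L] is a logarithm of [g] and moves [u0] to [y + L *m u0]. *)
Lemma affdense_log_preimage : affdense 1 G u0 -> affdense 0 log_preimage u0.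
Proof.
move=> du; have cu := cyclic_of_affdense1 du.
have [c c0 bnd] := bicomm_bound cu.
move=> y y0 eps e0; have [X VX Xu] := cu y; have [KX _] := VX.
have X00 : X 0 0 = 0 by have := entry00 u0 KX; rewrite Xu u00 mulr1 y0.
have EE' := expmxN_btrig KX; have E'E := expmxN_btrig (btrigN KX); rewrite opprK in E'E.
have VE' : bicomm (expmx (- X)).
  by apply: bicomm_expmx; rewrite -scaleN1r; exact: bicommZ.
have E'00 : (expmx (- X)) 0 0 = 1.
  by rewrite (expmx_diag _ (btrigN KX)) mxE X00 oppr0 cexp0.
have E00 : (expmx X) 0 0 = 1 by rewrite (expmx_diag _ KX) X00 cexp0.
have KE := btrig_expmx KX.
have addX L : btrig b L -> GRing.comm X L -> expmx (X + L) = expmx X * expmx L.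
  by move=> KL cXL; exact: expmxD_btrig KX KL cXL.
move: (expmx X) (expmx (- X)) EE' E'E VE' E'00 E00 KE addX.
move=> E E' EE' E'E VE' E'00 E00 KE addX.
have k0 : 0 < l1norm u0 + 1 by rewrite ltr_wpDl // l1norm_ge0.
have [d d0 hd] := logmx_near1 b (divr_gt0 e0 k0).
have k'0 : 0 < c * (l1norm E' + 1) by rewrite mulr_gt0 // ltr_wpDl // l1norm_ge0.
have Eu : (E *m u0) 0 0 = 1.
  by rewrite entry00 // u00 mulr1.
have [g Gg hg] := du _ Eu _ (divr_gt0 d0 k'0).
  pose B := E' * g.
  have VB : bicomm B by apply: bicommM => //; exact: bicomm_G.
  have [KB _] := VB.
  have B1 : l1norm (B - 1) < d.
    apply: le_lt_trans (bnd _ (bicommB VB bicomm1)) _.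
    rewrite (mul_inv_sub _ _ E'E).
    move: hg; rewrite ltr_pdivlMr // mulrC -mulrA; apply: le_lt_trans.
    rewrite ler_wpM2l ?(ltW c0) //; apply: le_trans (l1normM _ _) _.
    by rewrite ler_wpM2r ?l1norm_ge0 // lerDl.
  have [nzB lB] := hd B KB B1; pose L := logmx B.
  have KL : btrig b L := btrig_logmx KB.
  have eL : expmx L = B := logmxK KB nzB.
  have B00 : B 0 0 = 1.
    rewrite /B ltrig0_mul_diag; [|by have [[]] := VE'|by have [] := GK Gg].
    by rewrite (G00 Gg) E'00 mulr1.
  (* The branch with [clog 1 = 0] keeps [X + L] in [log_preimage]. *)
  have L00 : L 0 0 = 0 by rewrite (logmx_diag _ KB nzB) B00 clog1.
  have cXL : GRing.comm X L.
    by apply: (comm_expmx_btrig KX KL); rewrite eL; exact: bicomm_comm.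
  exists (X + L).
    split; [exact: btrigD|by rewrite mxE X00 L00 addr0|].
    by rewrite (addX _ KL cXL) eL /B mulrA EE' mul1r.
  rewrite mulmxDl Xu addrC addKr; apply: le_lt_trans (l1normM _ _) _.
  move: lB; rewrite ltr_pdivlMr // -/L; apply: le_lt_trans.
  by rewrite ler_wpM2l ?l1norm_ge0 // lerDl.
Qed.

(** Write the target as [A *m u0] with [A = expmx X], and take a logarithm [L] of an element of [G]
    with [L *m u0] close to [X *m u0]. Then [bicomm_bound] makes [L - X] small, and
    [expmx L = A * expmx (L - X)] is close to [A]. *)
Lemma affdense_G : affdense 0 log_preimage u0 -> affdense 1 G u0.
Proof.
move=> du; have cu := cyclic_of_affdense0 du.
have [c c0 bnd] := bicomm_bound cu.
move=> y y1 eps e0.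
(* One more than the number of coordinates, so that the total perturbation stays strictly below
   [eps / 2]. *)
pose m : R := n.+2%:R; have m0 : 0 < m by rewrite ltr0n.
pose eta : R := eps / 2 / m; have eta0 : 0 < eta by rewrite !divr_gt0.
(* Zero coordinates are moved off 0, so that a matrix of [bicomm] sending [u0] to [y'] has a nonzero
   diagonal and thus a logarithm. *)
pose y' : 'cV[C]_n.+1 := \col_i (if y i 0 == 0 then eta%:C%C else y i 0).
have y'nz i : y' i 0 != 0.
  rewrite mxE; case: ifPn => // _; apply/eqP => -[] /eqP.
  by rewrite gt_eqF.
have y'1 : y' 0 0 = 1 by rewrite mxE y1 oner_eq0.
have y'y : l1norm (y' - y) < eps / 2.
  apply: (@le_lt_trans _ _ (\sum_(i < n.+1) eta)).
    apply: ler_sum => i _; rewrite big_ord1 !mxE; case: eqP => [->|_].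
      by rewrite subr0 normc_real ger0_norm // ltW.
    by rewrite subrr normc0 ltW.
  rewrite sumr_const card_ord -[ltLHS]mulr_natr /eta mulrAC ltr_pdivrMr //.
  by rewrite ltr_pM2l ?divr_gt0 // ltr_nat.
have [A VA Au] := cu y'; have [KA _] := VA.
have nzA : forall i, A i i != 0 by apply: (@diag_neq0 _ u0) => // i _; rewrite Au.
have A00 : A 0 0 = 1 by have := entry00 u0 KA; rewrite Au u00 mulr1 y'1.
pose X := logmx A; have KX : btrig b X := btrig_logmx KA.
have eX : expmx X = A := logmxK KA nzA.
have VX : bicomm X by apply: bicomm_log => //; rewrite eX.
have X00 : X 0 0 = 0 by rewrite (logmx_diag _ KA nzA) A00 clog1.
pose k : R := l1norm A * l1norm u0 + 1.
have k0 : 0 < k by rewrite ltr_wpDl // mulr_ge0 // l1norm_ge0.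
have ek : 0 < eps / 2 / k by rewrite !divr_gt0.
have [d d0 hd] := expR_near0 ek.
have Xu : (X *m u0) 0 0 = 0 by rewrite entry00 // X00 mul0r.
have [L lL hL] := du _ Xu _ (divr_gt0 d0 c0).
  have [KL _ GL] := lL; exists (expmx L) => //.
  have VD : bicomm (L - X) by apply: bicommB => //; exact: bicomm_log_preimage.
  have [KD _] := VD.
  have nD : l1norm (L - X) < d.
    apply: le_lt_trans (bnd _ VD) _; rewrite mulmxBl.
    by move: hL; rewrite ltr_pdivlMr // mulrC.
  have eL : expmx L = A * expmx (L - X).
    rewrite -eX -(expmxD_btrig KX KD); last exact: bicomm_comm.
    by congr expmx; rewrite addrC subrK.
  have -> : expmx L *m u0 - y = A *m ((expmx (L - X) - 1) *m u0) + (y' - y).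
    rewrite eL -Au mulmxA mulmxBr mulmx1 mulmxBl addrA subrK.
    by [].
  rewrite (splitr eps) (le_lt_trans (l1normD _ _)) // ltrD //.
  apply: le_lt_trans (l1normM _ _) _.
  have : l1norm (expmx (L - X) - 1) < eps / 2 / k.
    apply: le_lt_trans (expmx_to_near1 (expmx_to_expmx_btrig KD)) _.
    by apply: hd; rewrite l1norm_ge0.
  rewrite ltr_pdivlMr //; apply: le_lt_trans.
  apply: (@le_trans _ _ (l1norm A * (l1norm (expmx (L - X) - 1) * l1norm u0))).
    by rewrite ler_wpM2l ?l1norm_ge0 // l1normM.
  rewrite mulrCA ler_wpM2l ?l1norm_ge0 // lerDl //.
Qed.

End Core.

(** * Reduction of the affine statement *)

Section BlockIndices.
Variables (R : realType) (n r : nat) (eta : 'I_r -> nat).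
Variable eta_sum : (\sum_i eta i)%N = n.+1.
Local Notation C := R[i].

Definition block_of (i : 'I_n.+1) : 'I_r := tagnat.sig1 (cast_ord (esym eta_sum) i).

Definition block_idx k (x : 'I_(eta k)) : 'I_n.+1 := cast_ord eta_sum (tagnat.Rank k x).

Lemma block_idxP (i : 'I_n.+1) : exists k (x : 'I_(eta k)), i = block_idx x.
Proof.
exists (block_of i), (tagnat.sig2 (cast_ord (esym eta_sum) i)).
by rewrite /block_idx tagnat.sig2K cast_ordKV.
Qed.

Lemma block_of_idx k (x : 'I_(eta k)) : block_of (block_idx x) = k.
Proof. by rewrite /block_of /block_idx cast_ordK tagnat.Rank1K. Qed.

Lemma block_idx_val k (x : 'I_(eta k)) :
  block_idx x = (\sum_(l < r | (l < k)%N) eta l + x)%N :> nat.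
Proof. exact: tagnat.RankEsum. Qed.

(** The right side keeps the form to which the entries of [\mxdiag] unfold; [conform_mx] bridges two
    types and disappears once [k] and [l] are identified. *)
Lemma mxdiag_idx (B : forall k, 'M[C]_(eta k)) k l (x : 'I_(eta k)) (y : 'I_(eta l)) :
  castmx (eta_sum, eta_sum) (\mxdiag_(k < r) B k) (block_idx x) (block_idx y) =
  (if k == l then conform_mx 0 (B k) else 0 : 'M_(eta k, eta l)) x y.
Proof.
rewrite castmxE /block_idx !cast_ordK.
have := mxblockK (fun k l => if k == l then conform_mx 0 (B k) else 0 : 'M_(eta k,
  eta l)) k l.
by move=> /matrixP/(_ x y); rewrite mxE.
Qed.

Lemma KK_btrig (M : 'M[C]_n.+1) : KK eta_sum M <-> btrig block_of M.
Proof.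
split.
  case=> B TB ->; split.
  - move=> i j; rewrite addn0.
    have [k [x ->]] := block_idxP i; have [l [y ->]] := block_idxP j.
    rewrite mxdiag_idx; case: eqVneq => [kl|_ _]; last by rewrite mxE.
    case: l / kl y => y; rewrite conform_mx_id !block_idx_val ltn_add2l => xy.
    by have [/is_trig_mxP /(_ _ _ xy)] := TB k.
  - move=> i j.
    have [k [x ->]] := block_idxP i; have [l [y ->]] := block_idxP j.
    by rewrite mxdiag_idx !block_of_idx => /negbTE ->; rewrite mxE.
  - move=> i j.
    have [k [x ->]] := block_idxP i; have [l [y ->]] := block_idxP j.
    rewrite !mxdiag_idx !block_of_idx !eqxx => kl.
    by case: l / kl y => y; rewrite conform_mx_id; have [_] := TB k.
case=> M1 M2 M3; exists (fun k => \matrix_(x, y) M (block_idx x) (block_idx y)).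
  move=> k; split.
    apply/is_trig_mxP => x y xy; rewrite mxE M1 // addn0 !block_idx_val ltn_add2l //.
  by move=> x y; rewrite !mxE; apply: M3; rewrite !block_of_idx.
apply/matrixP => i j.
have [k [x ->]] := block_idxP i; have [l [y ->]] := block_idxP j.
rewrite mxdiag_idx; case: eqVneq => [kl|kl].
  by case: l / kl y => y; rewrite conform_mx_id mxE.
by rewrite mxE M2 // !block_of_idx.
Qed.

Lemma u0_idx k (x : 'I_(eta k)) :
  u0 R eta_sum (block_idx x) 0 = if x == 0 :> nat then 1 else 0.
Proof.
rewrite /u0 castmxE /block_idx cast_ordK /= !mxE.
by rewrite tagnat.Rank2K.
Qed.

Lemma u00E : u0 R eta_sum 0 0 = 1.
Proof.
have [k [x xE]] := block_idxP 0; rewrite xE u0_idx.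
have /esym/eqP := block_idx_val x; rewrite -xE addn_eq0 => /andP[_ ->] //.
Qed.

Lemma u0_lead : (forall k, (0 < eta k)%N) -> forall i, exists i',
  [/\ block_of i' = block_of i, u0 R eta_sum i' 0 = 1
    & forall j : 'I_n.+1, (j < i')%N -> block_of j != block_of i'].
Proof.
move=> eta_pos i; exists (block_idx (Ordinal (eta_pos (block_of i)))).
rewrite !block_of_idx u0_idx; split => // j.
have [k [x ->]] := block_idxP j; rewrite block_of_idx => ji.
apply/eqP => ki; move: x ji; rewrite ki => x; rewrite !block_idx_val addn0.
by rewrite ltnNge leq_addr.
Qed.

End BlockIndices.

(** * Topological density in terms of the norm *)

Section Density.
Context {R : realType}.
Local Notation C := R[i].

Lemma dense_l1normP n (D : set 'cV[C]_n) : dense D <->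
  forall w (eps : R), 0 < eps -> exists2 s, D s & l1norm (s - w) < eps.
Proof.
split=> [dD w eps e0|h O [w Ow] oO].
  (* Dividing by [n.+1] keeps the sum of [n] errors strictly below [eps], also for [n = 0]. *)
  pose d : R := eps / n.+1%:R; have d0 : 0 < d by rewrite divr_gt0.
  have dC : 0 < d%:C%C :> C by rewrite ltcR.
  have [|s [/interior_subset Bs Ds]] := dD (ball w d%:C%C)^° _ (open_interior _).
    by exists w; exact: nbhsx_ballx.
  exists s => //; case: Bs => _ Bs.
  apply: (@le_lt_trans _ _ (\sum_(i < n) d)).
    apply: ler_sum => i _; rewrite big_ord1 !mxE -normcN opprB ltW //.
    by have := Bs i 0; rewrite /ball /= normr_normc ltcR.
  rewrite sumr_const card_ord -[ltLHS]mulr_natr /d mulrAC ltr_pdivrMr ?ltr0n //.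
  by rewrite ltr_pM2l // ltr_nat.
have /nbhs_ballP [e /= e0 eO] : nbhs w O by exact: open_nbhs_nbhs.
have eR : e = (complex.Re e)%:C%C by rewrite RRe_real // gtr0_real.
have re0 : 0 < complex.Re e by move: e0; rewrite ltcE /= => /andP[].
have [s Ds ws] := h w _ re0; exists s; split => //; apply: eO; split => // i j.
rewrite eR /ball /= normr_normc ltcR; apply: le_lt_trans ws.
by apply: le_trans (l1norm_entry _ i j); rewrite !mxE -normcN opprB.
Qed.

Lemma l1norm_cV1 n (x : 'cV[C]_(1 + n)) : l1norm x = normc (x 0 0) + l1norm (dsubmx x).
Proof.
rewrite /l1norm big_ord_recl big_ord1; congr (_ + _).
by apply: eq_bigr => i _; rewrite !big_ord1 mxE; congr (normc (x _ _)); apply: val_inj.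
Qed.

End Density.

(** * Affine maps as matrices *)

Section Affine.
Context {R : realType} {n : nat}.
Local Notation C := R[i].
Local Notation M := 'M[C]_n.+1.
Implicit Types (f g : MA R n) (v : 'cV[C]_n) (x : 'cV[C]_n.+1).

Lemma Phi_id : Phi (aff_id R n) = 1.
Proof. by rewrite /Phi /aff_id /= -scalar_mx_block. Qed.

Lemma Phi_comp f g : Phi (aff_comp f g) = Phi f * Phi g.
Proof.
have -> : Phi f * Phi g = Phi f *m Phi g by [].
rewrite /Phi [RHS](@mulmx_block _ 1 n 1 n 1 n) /aff_comp /=.
by rewrite !mul0mx !mulmx0 !mul1mx !mulmx1 !add0r ?addr0 addrC.
Qed.

Lemma ord0_lshift : 0 = lshift n 0 :> 'I_(1 + n).
Proof. exact: val_inj. Qed.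

Lemma col0 (x : 'cV[C]_(1 + n)) : x 0 0 = usubmx x 0 0.
Proof. by rewrite mxE -ord0_lshift. Qed.

Lemma col_mx_ord0 (c : C) v : (col_mx c%:M v : 'cV[C]_(1 + n)) 0 0 = c.
Proof. by rewrite col0 col_mxKu mxE eqxx. Qed.

Lemma Phi_col f (a : 'cV[C]_1) v :
  Phi f *m (col_mx a v : 'cV[C]_(1 + n)) = col_mx a (f.2 *m a + f.1 *m v).
Proof. by rewrite /Phi (@mul_block_col _ 1 n 1 n 1) mul1mx mul0mx addr0. Qed.

Lemma Psi_col f (a : 'cV[C]_1) v :
  Psi f *m (col_mx a v : 'cV[C]_(1 + n)) = col_mx (0 : 'cV_1) (f.2 *m a + f.1 *m v).
Proof. by rewrite /Psi (@mul_block_col _ 1 n 1 n 1) !mul0mx addr0. Qed.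

Lemma Phi_row f x : (Phi f *m x) 0 0 = x 0 0.
Proof. by rewrite -[x](@vsubmxK _ 1 n) Phi_col !col0 !col_mxKu. Qed.

(** Homogeneous coordinates, in which the affine action becomes the linear action of [Phi]. *)
Definition hcol v : 'cV[C]_n.+1 := col_mx 1%:M v : 'cV[C]_(1 + n).

Lemma Phi_hcol f v : Phi f *m hcol v = hcol (aff_app f v).
Proof. by rewrite Phi_col mulmx1 addrC. Qed.

Lemma Psi_hcol f v : Psi f *m hcol v = (col_mx (0 : 'cV_1) (aff_app f v) :
  'cV[C]_(1 + n)).
Proof. by rewrite Psi_col mulmx1 addrC. Qed.

Lemma hcolK (x : 'cV[C]_(1 + n)) : x 0 0 = 1 -> hcol (dsubmx x) = x.
Proof.
move=> x1; have e : 1%:M = usubmx x.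
  by apply/matrixP => i j; rewrite !ord1 -col0 x1 mxE eqxx.
by rewrite /hcol e vsubmxK.
Qed.

Lemma Phi00 f : (Phi f) 0 0 = 1.
Proof.
have := @block_mxEul C 1 n 1 n 1%:M 0 f.2 f.1 0 0.
by rewrite -!ord0_lshift [RHS]mxE eqxx.
Qed.

(** With [Psi_row], this describes [calF] by the vanishing of the first row. *)
Lemma PsiP (A : M) : (forall j, A 0 j = 0) -> exists h, Psi h = A.
Proof.
move=> A0; exists (@drsubmx _ 1 n 1 n A, @dlsubmx _ 1 n 1 n A).
have ul : @ulsubmx _ 1 n 1 n A = 0.
  by apply/matrixP => i j; rewrite !mxE ord1 -ord0_lshift A0.
have ur : @ursubmx _ 1 n 1 n A = 0.
  by apply/matrixP => i j; rewrite !mxE ord1 -ord0_lshift A0.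
by have := @submxK _ 1 n 1 n A; rewrite ul ur.
Qed.

Lemma Psi_row f j : (Psi f) 0 j = 0.
Proof.
case: (@split_ordP 1 n j) => k ->.
  by have := @block_mxEul C 1 n 1 n 0 0 f.2 f.1 0 k; rewrite -{1}ord0_lshift [RHS]mxE.
by have := @block_mxEur C 1 n 1 n 0 0 f.2 f.1 0 k; rewrite -{1}ord0_lshift [RHS]mxE.
Qed.

Lemma aff_inverse_Phi f g : aff_inverse f g -> Phi f * Phi g = 1.
Proof. by case=> fg _; rewrite -Phi_comp fg Phi_id. Qed.

(** Multiplication by [Phi p] is invertible and preserves the first coordinate. Differences of
    vectors in the hyperplane have first coordinate 0, so dropping that coordinate does not change
    their norm, and errors change by bounded factors only. *)
Lemma dense_affdense (p q : MA R n) (S : set M) (u : 'cV[C]_n.+1) (c : C) :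
  Phi p * Phi q = 1 -> (forall A, S A -> (A *m u) 0 0 = c) ->
  dense [set @dsubmx _ 1 n 1 (Phi p *m (A *m u)) | A in S] <-> affdense c S u.
Proof.
move=> pq Sc; have qp : Phi q *m Phi p = 1%:M by apply: mulmx1C.
split=> [/dense_l1normP h y y0 eps e0|h].
  have k0 : 0 < l1norm (Phi q) + 1 by rewrite ltr_wpDl // l1norm_ge0.
  have [_ [A SA <-] hA] := h (@dsubmx _ 1 n 1 (Phi p *m y)) _ (divr_gt0 e0 k0).
  exists A => //.
  have -> : A *m u - y = Phi q *m (Phi p *m (A *m u - y)).
    by rewrite mulmxA qp mul1mx.
  apply: le_lt_trans (l1normM _ _) _.
  have z0 : (Phi p *m (A *m u - y)) 0 0 = 0 by rewrite Phi_row mxE (Sc A SA) mxE y0 subrr.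
  rewrite -linearB /= -mulmxBr ltr_pdivlMr // mulrC in hA; apply: le_lt_trans hA.
  rewrite (@l1norm_cV1 _ n (Phi p *m _)) z0 normc0 add0r.
  by rewrite ler_wpM2r ?l1norm_ge0 // lerDl.
apply/dense_l1normP => w eps e0.
have k0 : 0 < l1norm (Phi p) + 1 by rewrite ltr_wpDl // l1norm_ge0.
pose z : 'cV[C]_n.+1 := col_mx c%:M w : 'cV[C]_(1 + n).
have z0 : (Phi q *m z) 0 0 = c by rewrite Phi_row col_mx_ord0.
have [A SA hA] := h _ z0 _ (divr_gt0 e0 k0).
exists (@dsubmx _ 1 n 1 (Phi p *m (A *m u))); first by exists A.
have -> : w = @dsubmx _ 1 n 1 (Phi p *m (Phi q *m z)).
  by rewrite mulmxA (pq : Phi p *m Phi q = 1%:M) mul1mx col_mxKd.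
rewrite -linearB /= -mulmxBr; apply: (@le_lt_trans _ _ (l1norm (Phi p *m (A *m u - Phi q *m z)))).
  by rewrite [leRHS](@l1norm_cV1 _ n (Phi p *m _)) lerDr normc_ge0.
apply: le_lt_trans (l1normM _ _) _; rewrite ltr_pdivlMr // mulrC in hA.
by apply: le_lt_trans hA; rewrite ler_wpM2r ?l1norm_ge0 // lerDl.
Qed.

Lemma tendsto_cst m k (X : 'M[C]_(m, k)) : tendsto (fun=> X) X.
Proof.
rewrite /tendsto (_ : (fun=> _) = fun=> 0); first exact: cvg_cst.
by apply/funext => K; rewrite subrr l1norm0.
Qed.

Lemma exp_psum_conj (P Q A : M) K : Q * P = 1 ->
  exp_psum K (P * A * Q) = P * exp_psum K A * Q.
Proof.
move=> QP; rewrite /exp_psum mulr_sumr mulr_suml; apply: eq_bigr => k _.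
rewrite -scalerAr -scalerAl; congr (_ *: _).
elim: (k : nat) => [|j IH].
  by rewrite !expr0 mulr1; apply/esym; exact: (mulmx1C QP).
by rewrite !exprS IH -!mulrA (mulrA Q) QP mul1r.
Qed.

Lemma expmx_to_conj (P Q A X : M) : Q * P = 1 -> expmx_to A X ->
  expmx_to (P * A * Q) (P * X * Q).
Proof.
move=> QP AX; rewrite /expmx_to (_ : (fun K => _) = fun K => P *m exp_psum K A *m Q).
  by apply: tendsto_mul; [apply: tendsto_mul => //|]; exact: tendsto_cst.
by apply/funext => K; rewrite exp_psum_conj.
Qed.

End Affine.

Lemma mul_row0 (R : realType) n m (A : 'M[R[i]]_n.+1) (B : 'M[R[i]]_(n.+1, m)) j :
  (forall k, A 0 k = 0) -> (A *m B) 0 j = 0.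
Proof. by move=> A0; rewrite mxE big1 // => k _; rewrite A0 mul0r. Qed.

Lemma Phi_row_mx (R : realType) n m (f : MA R n) (A : 'M[R[i]]_(n.+1, m)) j :
  (Phi f *m A) 0 j = A 0 j.
Proof.
by have := Phi_row f (col j A); rewrite [RHS]mxE => <-;
  rewrite colE mulmxA -colE [RHS]mxE.
Qed.

Lemma conj_unconj (F : pzRingType) (P Q A : F) : Q * P = 1 -> Q * (P * A * Q) * P = A.
Proof. by move=> QP; rewrite -!mulrA QP mulr1 mulrA QP mul1r. Qed.

Theorem theorem1p1 (R : realType) (n : nat) (n_ge1 : (1 <= n)%N)
    (G : set (MA R n)) (G_grp : is_subgroup_GA G) (G_abel : is_abelian G)
    (r : nat) (eta : 'I_r -> nat) (eta_pos : forall i, (0 < eta i)%N)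
    (eta_sum : (\sum_i eta i)%N = n.+1)
    (P : 'M[R[i]]_n.+1) (P_Phi : (@Phi R n @` GA) P)
    (PG : [set invmx P *m M *m P | M in @Phi R n @` G]
            `<=` KKstar eta_sum `&` @Phi R n @` GA) :
  [<-> hypercyclic G;
       dense (aff_orbit G (w0 eta_sum P));
       zmod_closed (mem (aff_orbit (frakg eta_sum G P) (w0 eta_sum P)))
       /\ dense (aff_orbit (frakg eta_sum G P) (w0 eta_sum P))].
Proof.
case: P_Phi PG => p [q pq] <- PG {P}.
have pq1 := aff_inverse_Phi pq.
have qp1 : Phi q * Phi p = 1 by apply: (mulmx1C pq1).
have Vp : invmx (Phi p) = Phi q.
  have up : Phi p \in unitmx by case: (mulmx1_unit pq1).
  by rewrite -[LHS]mulmx1 -(pq1 : Phi p *m Phi q = 1%:M) mulKmx.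
(* The conjugate of the group that lies inside K; it is the group [G] of the abstract argument. *)
pose Gm := [set invmx (Phi p) *m M *m Phi p | M in @Phi R n @` G].
have GmE f : G f -> Gm (Phi q * Phi f * Phi p).
  by move=> Gf; exists (Phi f); [exists f|rewrite Vp].
have GmP A : Gm A -> exists2 f, G f & A = Phi q * Phi f * Phi p.
  by case=> _ [f Gf <-] <-; exists f; rewrite ?Vp.
have [GGA Gid Gcomp Ginv] := G_grp.
have mulGm f g : Phi q * Phi f * Phi p * (Phi q * Phi g * Phi p) =
    Phi q * Phi (aff_comp f g) * Phi p.
  by rewrite Phi_comp -!mulrA (mulrA (Phi p) (Phi q)) pq1 mul1r.
pose b := block_of eta_sum; pose u := u0 R eta_sum.
have GK A : Gm A -> btrig b A by move=> /PG[[/KK_btrig]].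
have G00 A : Gm A -> A 0 0 = 1 by move=> /PG[_ [f _ <-]]; exact: Phi00.
have G1 : Gm 1 by rewrite -qp1 -[Phi q]mulr1 -Phi_id; exact: GmE.
have GM A B : Gm A -> Gm B -> Gm (A * B).
  move=> /GmP[f Gf ->] /GmP[g Gg ->]; rewrite mulGm; apply: GmE; exact: Gcomp.
have GV A : Gm A -> exists2 B, Gm B & A * B = 1.
  move=> /GmP[f Gf ->]; have [g Gg [fg _]] := Ginv f Gf.
  exists (Phi q * Phi g * Phi p); first exact: GmE.
  by rewrite mulGm fg Phi_id mulr1.
have Gab A B : Gm A -> Gm B -> GRing.comm A B.
  move=> /GmP[f Gf ->] /GmP[g Gg ->].
  by rewrite /GRing.comm !mulGm G_abel.
have u1 : u 0 0 = 1 := u00E R eta_sum.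
have lead := u0_lead R eta_sum eta_pos.
have homw : hcol (w0 eta_sum (Phi p)) = Phi p *m u.
  by rewrite /w0 hcolK // Phi_row.
(* In homogeneous coordinates, orbits of the affine group are images under [Phi p] of orbits of
   [Gm]. *)
have orbit v : aff_orbit G v =
    [set @dsubmx _ 1 n 1 (Phi p *m (A *m (Phi q *m hcol v))) | A in Gm].
  have E f : Phi p *m (Phi q * Phi f * Phi p *m (Phi q *m hcol v)) = hcol (aff_app f v).
    rewrite -Phi_hcol !mulmxA -[_ *m Phi p *m _]mulmxA.
    by rewrite (pq1 : Phi p *m Phi q = 1%:M) mul1mx mulmx1.
  apply/seteqP; split=> [_ [f Gf <-]|_ [_ /GmP[f Gf ->] <-]].
    by exists (Phi q * Phi f * Phi p); [exact: GmE|rewrite E col_mxKd].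
  by exists f; rewrite // E col_mxKd.
have Gu v A : Gm A -> (A *m (Phi q *m hcol v)) 0 0 = 1.
  by move=> GA; rewrite (entry00 _ (GK _ GA)) (G00 _ GA) mul1r Phi_row col_mx_ord0.
have denseG v : dense (aff_orbit G v) <-> affdense 1 Gm (Phi q *m hcol v).
  by rewrite orbit; apply: (dense_affdense pq1) => A; exact: Gu.
have qhomw : Phi q *m hcol (w0 eta_sum (Phi p)) = u.
  by rewrite homw mulmxA (qp1 : Phi q *m Phi p = 1%:M) mul1mx.
have conj_exp X : btrig b X -> expmx (Phi p *m X *m Phi q) = Phi p * expmx X * Phi q.
  by move=> KX; apply: expmx_to_expmx; apply: expmx_to_conj => //;
    exact: expmx_to_expmx_btrig KX.
have qp2 : Phi q *m Phi p = 1%:M by [].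
(* Conjugation by [Phi p] commutes with the exponential and preserves the vanishing of the first
   row, so it exchanges [rmg] and [log_preimage]; the base point becomes [u]. *)
have orbitg : aff_orbit (frakg eta_sum G (Phi p)) (w0 eta_sum (Phi p)) =
    [set @dsubmx _ 1 n 1 (Phi p *m (X *m u)) | X in log_preimage b Gm].
  apply/seteqP; split=> [_ [h [[[f Gf fE] [X KX XE]] _] <-]|_ [X [KX X0 GX] <-]].
    have bX : btrig b X by apply/KK_btrig.
    rewrite Vp in XE.
    exists X; last first.
      apply: (@etrans _ _ (@dsubmx _ 1 n 1 (Psi h *m hcol (w0 eta_sum (Phi p))))).
        by rewrite -XE -!mulmxA qhomw.
      by rewrite Psi_hcol col_mxKd.
    split=> //.
      have -> : X = Phi q *m (Psi h *m Phi p).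
        by rewrite -XE !mulmxA qp2 mul1mx -mulmxA qp2 mulmx1.
      by rewrite Phi_row_mx mul_row0 // => j; exact: Psi_row.
    have -> : expmx X = Phi q * Phi f * Phi p; last exact: GmE.
    have e : expmx (Psi h) = Phi p * expmx X * Phi q by rewrite -XE conj_exp.
    rewrite fE e (conj_unconj _ qp1); reflexivity.
  have X0j j : X 0 j = 0.
    have [->|j0] := eqVneq j 0; first exact: X0.
    by have [K1 _ _] := KX; rewrite K1 // addn0 lt0n.
  have [h hE] : exists h, Psi h = Phi p *m X *m Phi q.
    by apply: PsiP => j; rewrite -mulmxA Phi_row_mx mul_row0.
  exists h; last first.
    apply: (@etrans _ _ (@dsubmx _ 1 n 1 (Psi h *m hcol (w0 eta_sum (Phi p))))).
      by rewrite Psi_hcol col_mxKd.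
    by rewrite hE -!mulmxA qhomw.
  split; last by exists h.
  split; last by exists X; [apply/KK_btrig|rewrite Vp hE].
  have [f Gf fE] := GmP _ GX; exists f => //.
  have e : expmx (Psi h) = Phi p * expmx X * Phi q by rewrite hE conj_exp.
  rewrite e fE (conj_unconj _ pq1); reflexivity.
have denseg : dense (aff_orbit (frakg eta_sum G (Phi p)) (w0 eta_sum (Phi p))) <->
    affdense 0 (log_preimage b Gm) u.
  rewrite orbitg; apply: (dense_affdense pq1) => X [KX X0 _].
  by rewrite (entry00 _ KX) X0 mul0r.
(* The cycle (i), (ii), (iii), (i): each implication transports density by one of the lemmas on
   [affdense]. *)
tfae.
- case=> v /denseG dv; apply/denseG; rewrite qhomw.
  have v1 : (Phi q *m hcol v) 0 0 = 1 by rewrite Phi_row col_mx_ord0.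
  exact: (affdense1_u0 GK G1 Gab u1 lead v1 dv).
- move=> /denseG; rewrite qhomw => du; split; last first.
    by apply/denseg; exact: (affdense_log_preimage GK G1 Gab G00 u1 du).
  rewrite orbitg; split.
    rewrite inE; exists 0; first exact: (log_preimage0 b G1).
    by rewrite mul0mx mulmx0 linear0.
  move=> x y; rewrite !inE => -[X lX <-] [Y lY <-].
  exists (X - Y); first exact: (log_preimageB GK GM GV Gab lX lY).
  by rewrite mulmxBl mulmxBr linearB.
- case=> _ /denseg dg; exists (w0 eta_sum (Phi p)); apply/denseG; rewrite qhomw.
  exact: (affdense_G GK G1 Gab u1 lead dg).
Qed.
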